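(* For $r>0$ and $\alpha\in\mathbb R\cup\{\infty\}$ let $b_r(\alpha)$ be the Hausdorff dimension of $$M_r(\alpha)=\Big\{x\in(0,1)\setminus\mathbb Q:\ \lim_{n\to\infty}\frac1n\sum_{k=1}^n (b_k(x))^r=\alpha\Big\},$$ where $b_k(x)$ are the digits of the backward continued fraction expansion of $x$. Then for all $r>0$ and all $\alpha\in[2^r,\infty]$ we have $b_r(\alpha)=1$.
   Context: Every irrational $x\in(0,1)$ has a unique backward continued fraction expansion $$x=1-\cfrac{1}{b_1(x)-\cfrac{1}{b_2(x)-\ddots}},\qquad b_n(x)\in\mathbb N,\ b_n(x)\ge2.$$ Equivalently, with the R\'enyi map $R(x)=\frac1{1-x}-\left[\frac1{1-x}\right]$ on $[0,1)$ ($[\cdot]$ the floor function), $b_n(x)=\left[\frac{1}{1-R^{n-1}(x)}\right]+1$. *)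

(* Defs.v *)
From HB Require Import structures.
From mathcomp Require Import all_boot all_order all_algebra.
From mathcomp Require Import all_classical all_reals all_analysis.
Set Implicit Arguments.
Unset Strict Implicit.
Unset Printing Implicit Defensive.
Import Order.TTheory GRing.Theory Num.Theory.
Import numFieldNormedType.Exports.
Local Open Scope classical_set_scope.
Local Open Scope ring_scope.

Section Hausdorff.
Variable R : realType.
Implicit Types (U A : set R) (s d : R).

(* On set0 this is -oo, the supremum of the empty set of extended reals. *)
Definition ediam U : \bar R :=
  ereal_sup [set `|x - y|%:E | x in U & y in U].

(* |U|^s, where the empty set counts for 0 also when s = 0, whereas a
   singleton counts for 0^0 = 1, so that the case s = 0 is counting measure. *)
Definition diam_pow s U : \bar R :=
  if U == set0 then 0%E else poweR (ediam U) s.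

Definition delta_cover d A (U : nat -> set R) : Prop :=
  A `<=` \bigcup_i U i /\ forall i, (ediam (U i) <= d%:E)%E.

Definition hausdorff_premeasure s d A : \bar R :=
  ereal_inf [set (\sum_(0 <= i <oo) diam_pow s (U i))%E | U in delta_cover d A].

(* The premeasure is nonincreasing in d, so its limit as d -> 0+ is this
   supremum. *)
Definition hausdorff_measure s A : \bar R :=
  ereal_sup [set hausdorff_premeasure s d A | d in [set d : R | 0 < d]].

Definition hausdorff_dim A : \bar R :=
  ereal_inf [set s%:E | s in [set s : R | 0 <= s /\ hausdorff_measure s A = 0%E]].

End Hausdorff.

Section BackwardContinuedFraction.
Variable R : realType.
Implicit Types (x r : R) (n : nat) (alpha : \bar R).

Definition renyi x : R := (1 - x)^-1 - (Num.floor (1 - x)^-1)%:~R.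

(* Digits are numbered from 1: b_n(x) = bcf_digit x n for n >= 1 (the value at
   n = 0 is junk). *)
Definition bcf_digit x n : int := Num.floor (1 - iter n.-1 renyi x)^-1 + 1.

Definition digit_mean r x n : R :=
  n%:R^-1 * \sum_(1 <= k < n.+1) ((bcf_digit x k)%:~R : R) `^ r.

Definition digit_mean_set r alpha : set R :=
  [set x : R | [/\ 0 < x < 1, irrational x &
               (digit_mean r x n)%:E @[n --> \oo] --> alpha]].

End BackwardContinuedFraction.

(* Main.v *)
Require Import Defs.
From mathcomp Require Import all_boot all_order all_algebra.
From mathcomp Require Import all_classical all_reals all_analysis.
From mathcomp Require Import zify ring lra.
Set Implicit Arguments.
Unset Strict Implicit.
Unset Printing Implicit Defensive.
Import Order.TTheory GRing.Theory Num.Theory.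
Import numFieldNormedType.Exports.
Local Open Scope classical_set_scope.
Local Open Scope ring_scope.

(* Write F(a, e; y) = [0; a, e + y] for two steps of the regular continued fraction.  In
   backward continued fraction digits it prepends a - 1 digits 2 followed by e + 2, so x
   is coded by pairs (a_n, e_n), and the maps F(a, e; .) are Moebius with nonnegative
   matrices of determinant 1.  Let T be the set of t in [0, 1) with a_n, e_n <= M_n for a
   quadratic M_n; a union bound over the first violation gives T positive Lebesgue outer
   measure.  For t in T, insert into its expansion one extra pair (L_k, B_k) per perfect
   square position, of polynomial size in k (and with (B_k)^r / L_k close to
   alpha - 2^r, or tending to infinity if alpha is infinite).  The inserted pairs dominate
   all the others in number of digits, so the r-th power mean of the resulting point g(t)
   tends to alpha.  On the other hand, the insertions made in the first n positions cost
   only a factor exp(o(n)) in the cylinder lengths, which decay exponentially; hence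
   |t - t'| <= C |g(t) - g(t')|^s on T for every s < 1, and a cover of g(T) with small
   s-dimensional sum would pull back to a cover of T of small length. *)

(** * Hausdorff measure *)

Lemma ediam_ge0 (R : realType) (U : set R) : U !=set0 -> (0 <= ediam U)%E.
Proof.
move=> [x Ux]; apply: ereal_sup_ubound; exists x => //; exists x => //.
by rewrite subrr normr0.
Qed.

Lemma diam_pow_ge0 (R : realType) (s : R) (U : set R) : (0 <= diam_pow s U)%E.
Proof. by rewrite /diam_pow; case: ifP => // _; exact: poweR_ge0. Qed.

Lemma diam_pow_real (R : realType) (s d : R) (U : set R) :
  U !=set0 -> (ediam U <= d%:E)%E ->
  diam_pow s U = ((fine (ediam U)) `^ s)%:E.
Proof.
move=> U0 Ud; rewrite /diam_pow ifF; last by apply/negP => /eqP UE; case: U0 => x; rewrite UE.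
rewrite -{1}(@fineK _ (ediam U)) // ge0_fin_numE ?ediam_ge0 //.
by apply: le_lt_trans Ud _; rewrite ltry.
Qed.

Lemma hausdorff_measure_ge (R : realType) (s d : R) (A : set R) (m : \bar R) :
  0 < d ->
  (forall U, delta_cover d A U -> (m <= \sum_(0 <= i <oo) diam_pow s (U i))%E) ->
  (m <= hausdorff_measure s A)%E.
Proof.
move=> d0 H; apply: (@le_trans _ _ (hausdorff_premeasure s d A)).
  by apply: le_ereal_inf_tmp => _ [U cU <-]; exact: H.
by apply: ereal_sup_ubound; exists d.
Qed.

(** Covering [0, 1) by n intervals of length 1/n gives the sum n^(1 - s), which tends to 0 as n
    grows. *)
Lemma hausdorff_measure0_gt1 (R : realType) (s : R) (A : set R) :
  A `<=` `[0, 1[ -> 1 < s -> hausdorff_measure s A = 0%E.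
Proof.
move=> A01 s1.
apply/eqP; rewrite eq_le; apply/andP; split; last first.
  apply: (@hausdorff_measure_ge _ s 1) => // U _.
  by apply: nneseries_ge0 => n _ _; exact: diam_pow_ge0.
apply: ge_ereal_sup => _ [d d0 <-].
apply/lee_addgt0Pr => e e0; rewrite add0e.
have s10 : 0 < s - 1 by rewrite subr_gt0.
(* The first summand makes 1/n at most d, the second makes n^(1 - s) at most e. *)
pose K := d^-1 + (e^-1) `^ ((s - 1)^-1) + 1.
have K1 : 0 < K by rewrite ltr_wpDl // addr_ge0 ?powR_ge0 // invr_ge0 ltW.
pose n := (Num.truncn K).+1.
have nK : K <= n%:R by rewrite ltW // truncnS_gt.
have n0 : 0 < n%:R :> R by rewrite ltr0n.
pose U (i : nat) : set R := if (i < n)%N then `[i%:R / n%:R, i.+1%:R / n%:R]%classic else set0.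
have diamU i : (i < n)%N -> (ediam (U i) <= (n%:R^-1)%:E)%E.
  move=> ilt; apply: ge_ereal_sup => _ [x + [y + <-]]; rewrite /U ilt /= !in_itv /=.
  move=> /andP[x1 x2] /andP[y1 y2]; rewrite lee_fin.
  have E : i.+1%:R / n%:R = i%:R / n%:R + n%:R^-1 :> R by rewrite -natr1 mulrDl mul1r.
  rewrite E in x2 y2; rewrite ler_norml; apply/andP; split; lra.
have U0 i : (n <= i)%N -> U i = set0 by move=> ni; rewrite /U ltnNge ni.
have cU : delta_cover d A U.
  split.
    move=> x /A01 /=; rewrite in_itv /= => /andP[x0 x1].
    have xn : 0 <= x * n%:R by rewrite mulr_ge0 // ltW.
    have /andP[a b] := truncn_itv xn.
    exists (Num.truncn (x * n%:R)) => //; rewrite /U.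
    have -> : (Num.truncn (x * n%:R) < n)%N.
      by rewrite truncn_lt_nat // -[ltRHS]mul1r ltr_pM2r.
    by rewrite /= in_itv /= ler_pdivrMr // a /= ler_pdivlMr // ltW.
  move=> i; case: (ltnP i n) => ni.
    apply: (le_trans (diamU _ ni)); rewrite lee_fin.
    rewrite -[leRHS]invrK lef_pV2 ?posrE ?invr_gt0 //.
    apply: le_trans nK; rewrite /K -addrA lerDl addr_ge0 ?powR_ge0 //.
  rewrite U0 //; apply: ge_ereal_sup => _ [x []].
apply: (@le_trans _ _ (\sum_(0 <= i <oo) diam_pow s (U i))%E).
  by apply: ereal_inf_lbound; exists U.
rewrite (nneseries_split 0 n) ?add0n; last by move=> *; exact: diam_pow_ge0.
rewrite [X in (_ + X)%E]eseries0 ?adde0; last first.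
  by move=> i ni _; rewrite U0 // /diam_pow eqxx.
apply: (@le_trans _ _ (\sum_(0 <= i < n) ((n%:R^-1) `^ s)%:E)%E).
  rewrite big_nat_cond [leRHS]big_nat_cond; apply: lee_sum => i /andP[/andP[_ ni] _].
  have Uin : U i !=set0.
    exists (i%:R / n%:R); rewrite /U ni /= in_itv /= lexx /= ler_pM2r ?invr_gt0 //.
    by rewrite ler_nat.
  rewrite (diam_pow_real _ Uin (diamU _ ni)) lee_fin.
  have fd : (fine (ediam (U i)))%:E = ediam (U i).
    rewrite fineK // ge0_fin_numE ?ediam_ge0 //.
    by apply: le_lt_trans (diamU _ ni) _; rewrite ltry.
  apply: ge0_ler_powR; rewrite ?nnegrE ?invr_ge0 //.
  - by apply: ltW; apply: lt_trans s1.
  - by rewrite fine_ge0 // ediam_ge0.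
  - by rewrite -lee_fin fd diamU.
rewrite sumEFin lee_fin big_const_nat subn0 iter_addr_0 -[X in X *+ _]mulr1 -mulrnAr.
have nV0 : n%:R^-1 != 0 :> R by rewrite invr_neq0 // gt_eqF.
have -> : (n%:R^-1) `^ s = (n%:R^-1) `^ (s - 1) * n%:R^-1 :> R.
  rewrite -[X in _ = _ * X]powRr1 ?invr_ge0 // -powRD ?subrK //.
  by rewrite nV0 implybT.
rewrite -mulrA mulVf ?gt_eqF // mulr1 -powR_inv1 // -powRrM mulN1r powRN.
rewrite -[leRHS]invrK lef_pV2 ?posrE ?invr_gt0 ?powR_gt0 //.
have -> : e^-1 = ((e^-1) `^ ((s-1)^-1)) `^ (s - 1).
  by rewrite -powRrM mulVf ?gt_eqF // powRr1 // invr_ge0 ltW.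
apply: ge0_ler_powR; rewrite ?nnegrE ?powR_ge0 // ?ltW //.
apply: lt_le_trans nK; rewrite /K; rewrite -[ltLHS]add0r -addrA ltr_leD // ?invr_gt0 //.
by rewrite lerDl.
Qed.

(* The witness set T must have positive outer measure, phrased through covers by
   closed balls so that no measurability of T is needed. *)
Lemma hausdorff_measure_gt0 (R : realType) (s C m : R) (T A : set R) (g : R -> R) :
  0 <= s -> 0 < C -> 0 < m ->
  (forall c d : nat -> R, (forall i, 0 <= d i) ->
     T `<=` \bigcup_i [set` `[c i - d i, c i + d i]] ->
     (m%:E <= \sum_(0 <= i <oo) (2 * d i)%:E)%E) ->
  (forall t, T t -> A (g t)) ->
  (forall t t', T t -> T t' -> `|t - t'| <= C * `|g t - g t'| `^ s) ->
  hausdorff_measure s A != 0%E.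
Proof.
move=> s0 C0 m0 fat gA gC.
have D0 : 0 < 2 * C by rewrite mulr_gt0.
suff H : ((m / (2 * C))%:E <= hausdorff_measure s A)%E.
  by rewrite gt_eqF //; apply: lt_le_trans H; rewrite lte_fin divr_gt0.
apply: (@hausdorff_measure_ge _ s 1) => // U [AU dU].
pose V i := [set t | T t /\ U i (g t)].
(* Each [U i] is pulled back to a ball around some point of T mapped into [U i], with radius given
   by the Hoelder bound. If no such point exists, the default centre 0 with radius 0 adds nothing to
   the sum. *)
pose c i : R := xget 0 (V i).
pose d i : R := if `[< V i !=set0 >] then C * (fine (ediam (U i))) `^ s else 0.
have fU i : U i !=set0 -> (fine (ediam (U i)))%:E = ediam (U i).
  move=> Ui; rewrite fineK // ge0_fin_numE ?ediam_ge0 //.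
  by apply: le_lt_trans (dU i) _; rewrite ltry.
have d0 i : 0 <= d i.
  by rewrite /d; case: asboolP => // ?; rewrite mulr_ge0 ?powR_ge0 // ltW.
have dD i : ((2 * d i)%:E <= (2 * C)%:E * diam_pow s (U i))%E.
  rewrite /d; case: asboolP => [[t [Tt Ut]]|_]; last first.
    by rewrite mulr0 mule_ge0 ?diam_pow_ge0 // lee_fin ltW.
  have Ui : U i !=set0 by exists (g t).
  by rewrite (diam_pow_real _ Ui (dU i)) -EFinM lee_fin mulrA.
have TV : T `<=` \bigcup_i [set` `[c i - d i, c i + d i]].
  move=> t Tt; have [i _ Ui] := AU _ (gA _ Tt).
  exists i => //.
  have Vt : V i t by [].
  have Vc : V i (c i) by rewrite /c; case: xgetP => [y -> //|/(_ t)].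
  have Un : U i !=set0 by exists (g t).
  have : `|t - c i| <= d i.
    rewrite /d; case: asboolP => [_|]; last by case; exists t.
    apply: le_trans (gC _ _ Tt Vc.1) _; rewrite ler_pM2l //.
    apply: ge0_ler_powR; rewrite ?nnegrE ?fine_ge0 ?ediam_ge0 //.
    rewrite -lee_fin fU //; apply: ereal_sup_ubound; exists (g t) => //.
    by exists (g (c i)) => //; exact: Vc.2.
  by rewrite ler_norml /= in_itv /= => /andP[? ?]; apply/andP; split; lra.
have := fat c d d0 TV => Hm.
rewrite mulrC EFinM lee_pdivrMl // -nneseriesZl; last first.
  by move=> *; exact: diam_pow_ge0.
apply: (le_trans Hm); apply: lee_nneseries => [i _ _|i _]; last exact: dD.
by rewrite lee_fin mulr_ge0.
Qed.

Lemma hausdorff_dim_eq1 (R : realType) (A : set R) :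
  A `<=` `[0, 1[ ->
  (forall s : R, 0 <= s -> s < 1 -> hausdorff_measure s A != 0%E) ->
  hausdorff_dim A = 1%E.
Proof.
move=> A01 H; apply/eqP; rewrite eq_le; apply/andP; split.
  apply/lee_addgt0Pr => e e0; apply: ereal_inf_lbound; exists (1 + e) => //; split.
    by rewrite addr_ge0 // ltW.
  by apply: hausdorff_measure0_gt1 => //; rewrite ltrDl.
apply: le_ereal_inf_tmp => _ [s [s0 /eqP Hs] <-]; rewrite lee_fin leNgt.
by apply/negP => /(H s s0); rewrite Hs.
Qed.

(** * A set of positive measure with controlled expansions *)

(* Two steps of the regular continued fraction: [cf2 (a, e) y = [0; a, e + y]].  In terms
   of backward continued fractions it prepends the digits 2, ..., 2, e + 2, with
   a - 1 digits 2. *)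
Definition cf2 (R : realType) (l : nat * nat) (y : R) : R :=
  (l.1%:R + (l.2%:R + y)^-1)^-1.

(* [h] is the Moebius map of a matrix of determinant 1 with bottom row (u, v). *)
Definition mob (R : realType) (h : R -> R) (u v : R) : Prop :=
  [/\ 0 <= u, 0 < v & forall y y', 0 <= y -> 0 <= y' ->
      (h y - h y') * ((u * y + v) * (u * y' + v)) = y - y'].

Lemma cf2_ge0 (R : realType) l (y : R) : 0 <= y -> 0 <= cf2 l y.
Proof. by move=> y0; rewrite invr_ge0 addr_ge0 // invr_ge0 addr_ge0. Qed.

Lemma mob_id (R : realType) : mob (@id R) 0 1.
Proof. by split=> // y y' _ _; rewrite !mul0r !add0r !mulr1. Qed.

(** The map [cf2 (a, e)] has the matrix with rows (1, e) and (a, a e + 1), of determinant 1. The new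
    bottom row is the product of (u, v) with this matrix. *)
Lemma mob_cf2 (R : realType) (h : R -> R) u v l :
  (0 < l.1)%N -> (0 < l.2)%N -> mob h u v ->
  mob (h \o cf2 l) (u + l.1%:R * v) (l.2%:R * u + (l.1%:R * l.2%:R + 1) * v).
Proof.
case: l => [a e] /=; rewrite -!(ltr0n R) => a0 e0 [u0 v0 H].
split.
- by rewrite addr_ge0 // mulr_ge0 // ltW.
- by rewrite ltr_wpDl // ?mulr_ge0 ?mulr_gt0 ?(ltW e0) // ltr_wpDl // mulr_ge0 // ltW.
move=> y y' y0 y0' /=.
have ey : e%:R + y != 0 by rewrite gt_eqF // ltr_wpDr.
have ey' : e%:R + y' != 0 by rewrite gt_eqF // ltr_wpDr.
have D (y1 : R) : 0 <= y1 -> a%:R * (e%:R + y1) + 1 != 0.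
  by move=> ?; rewrite gt_eqF // ltr_wpDl // mulr_ge0 ?(ltW a0) // addr_ge0 // ltW.
have F (y1 : R) : 0 <= y1 -> cf2 (a, e) y1 = (e%:R + y1) / (a%:R * (e%:R + y1) + 1).
  move=> y10; rewrite /cf2 /=; have := D _ y10; have : e%:R + y1 != 0 by rewrite gt_eqF // ltr_wpDr.
  by move=> p q; field; do ?[apply/andP; split].
have U (y1 : R) : 0 <= y1 -> (u + a%:R * v) * y1 + (e%:R * u + (a%:R * e%:R + 1) * v) =
   (u * cf2 (a, e) y1 + v) * (a%:R * (e%:R + y1) + 1).
  by move=> y10; rewrite F //; have := D _ y10 => ?; field.
rewrite (U _ y0) (U _ y0') mulrACA [LHS]mulrA H ?cf2_ge0 // (F _ y0) (F _ y0').
by field; rewrite !D.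
Qed.

Lemma mob_le (R : realType) (h : R -> R) u v y y' :
  mob h u v -> 0 <= y -> y <= y' -> h y <= h y'.
Proof.
move=> [u0 v0 H] y0 yy'; have y'0 := le_trans y0 yy'.
rewrite -subr_ge0 -(@pmulr_lge0 _ ((u * y' + v) * (u * y + v))) ?H ?subr_ge0 //.
by rewrite mulr_gt0 // ltr_wpDl // mulr_ge0.
Qed.

(** The increment of h over [y, y'] is at most (y' - y) / v^2, whereas h 1 - h 0 = 1 / ((u + v) v)
    is at least 1 / (2 v^2) because u <= v. *)
Lemma mob_distortion (R : realType) (h : R -> R) u v y y' :
  mob h u v -> u <= v -> 0 <= y -> y <= y' ->
  h y' - h y <= 2 * (y' - y) * (h 1 - h 0).
Proof.
move=> [u0 v0 H] uv y0 yy'; have y'0 := le_trans y0 yy'.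
have D (z : R) : 0 <= z -> v <= u * z + v by move=> z0; rewrite lerDr mulr_ge0.
have P : v * v <= (u * y' + v) * (u * y + v) by rewrite ler_pM ?D // ltW.
have P0 : 0 < (u * y' + v) * (u * y + v) by apply: lt_le_trans P; rewrite mulr_gt0.
have E := H _ _ y'0 y0.
have E1 := H _ _ (ler01) (lexx 0); rewrite mulr1 mulr0 add0r subr0 in E1.
set X := h y' - h y in E *; set L := h 1 - h 0 in E1 *.
have L0 : 0 <= L.
  by rewrite -(@pmulr_lge0 _ ((u + v) * v)) ?E1 // mulr_gt0 // ltr_wpDl.
have X0 : 0 <= X by rewrite -(@pmulr_lge0 _ _ _ P0) E subr_ge0.
have L1 : 1 <= L * (2 * v * v).
  by rewrite -{1}E1 ler_wpM2l // ler_wpM2r ?(ltW v0) //; lra.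
have XE : X * (v * v) <= y' - y by rewrite -E ler_wpM2l.
have X1 : X * 1 <= X * (L * (2 * v * v)) by rewrite ler_wpM2l.
have X2 : 2 * L * (X * (v * v)) <= 2 * L * (y' - y) by rewrite ler_wpM2l // mulr_ge0.
nra.
Qed.

(** The cylinders are adjacent, since [cf2 (a, e) 1] equals [cf2 (a, e.+1) 0]. The inner sum
    telescopes to at most the increment of h over [1 / (k + 2), 1 / (k + 1)], and the outer sum
    telescopes in turn. *)
Lemma sum_cf2_le (R : realType) (h : R -> R) (M : nat) :
  (forall y y', 0 <= y -> y <= y' -> h y <= h y') ->
  \sum_(k < M) \sum_(j < M)
    (h (cf2 (k.+1, j.+1) 1) - h (cf2 (k.+1, j.+1) 0)) <= h 1 - h 0.
Proof.
move=> hh.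
apply: (@le_trans _ _ (\sum_(k < M) (h (k.+1%:R^-1) - h (k.+2%:R^-1)))).
  apply: ler_sum => k _.
  pose f j := h ((k.+1%:R + j.+1%:R^-1)^-1).
  rewrite (eq_bigr (fun j : 'I_M => f j.+1 - f j)); last first.
    by move=> j _; rewrite /f /cf2 /= addr0 natr1.
  rewrite -(big_mkord xpredT (fun j => f j.+1 - f j)) telescope_sumr // /f.
  rewrite lerB //.
    apply: hh; first by rewrite invr_ge0 addr_ge0 // invr_ge0.
    by rewrite lef_pV2 ?posrE ?ltr_wpDr ?invr_ge0 // lerDl invr_ge0.
  by rewrite invr1 natr1.
pose f k := - h (k.+1%:R^-1).
rewrite (eq_bigr (fun j : 'I_M => f j.+1 - f j)); last first.
  by move=> j _; rewrite /f opprK addrC.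
rewrite -(big_mkord xpredT (fun j => f j.+1 - f j)) telescope_sumr // /f opprK addrC.
by rewrite invr1 lerD2l lerN2 hh.
Qed.

(** For increasing h these are the images of the y with y <= 1/M, whose first entry is at least M or
    missing, and of the y with first entry k + 1 and 1/y - (k + 1) <= 1/M, whose second entry is at
    least M or missing. Terminating expansions are thus removed as well. *)
Definition bad_letter (R : realType) (M : nat) (h : R -> R) : set R :=
  [set` `[h 0, h (M%:R^-1)]] `|`
  \big[setU/set0]_(k < M) [set` `[h ((k.+1%:R + M%:R^-1)^-1), h (k.+1%:R^-1)]].

(* The points [h y] where the first letter of the expansion of y exceeding its bound
   occurs in position k; level n of the expansion of y is allotted the bound M (i + n). *)
Fixpoint bad_at (R : realType) (M : nat -> nat) (k i : nat) (h : R -> R) : set R :=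
  if k is k'.+1 then
    \big[setU/set0]_(a < M i) \big[setU/set0]_(e < M i)
      bad_at M k' i.+1 (h \o cf2 (a.+1, e.+1))
  else bad_letter (M i) h.

Lemma measurable_bad_at (R : realType) (M : nat -> nat) k i (h : R -> R) :
  measurable (bad_at M k i h).
Proof.
elim: k i h => [|k IH] i h /=.
  by apply: measurableU; [|apply: bigsetU_measurable => j _]; exact: measurable_itv.
by apply: bigsetU_measurable => a _; apply: bigsetU_measurable => e _; exact: IH.
Qed.

Lemma lebesgue_measure_bigsetU_le (R : realType) n (A : nat -> set R) (b : nat -> R) :
  (forall k, (k < n)%N -> measurable (A k)) ->
  (forall k, (k < n)%N -> (lebesgue_measure (A k) <= (b k)%:E)%E) ->
  (lebesgue_measure (\big[setU/set0]_(k < n) A k) <= (\sum_(k < n) b k)%:E)%E.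
Proof.
move=> mA bA.
elim: n mA bA => [|n IH] mA bA; first by rewrite !big_ord0 measure0.
rewrite !big_ord_recr /= EFinD.
apply: (@le_trans _ _ (lebesgue_measure (\big[setU/set0]_(k < n) A k) +
                        lebesgue_measure (A n))%E).
  apply: measureU2; last exact: mA.
  by apply: bigsetU_measurable => j _; apply: mA; have := ltn_ord j; lia.
by apply: leeD; [apply: IH => k kn; [apply: mA|apply: bA]; lia | exact: bA].
Qed.

Lemma lebesgue_measure_itv_le (R : realType) (a b c : R) :
  0 <= c -> b - a <= c -> (lebesgue_measure [set` `[a, b]] <= c%:E)%E.
Proof.
move=> c0 bac; rewrite lebesgue_measure_itv /=; case: ifP => _; last by rewrite lee_fin.
by rewrite -EFinD lee_fin.
Qed.

(** Before applying h, the first interval has length 1/M and the k-th of the others at most (2/M) (1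
    / (k + 1) - 1 / (k + 2)), which telescopes to at most 2/M. Distortion doubles both, giving 2 + 4
    = 6. *)
Lemma lebesgue_measure_bad_letter (R : realType) M (h : R -> R) u v :
  (0 < M)%N -> mob h u v -> u <= v ->
  (lebesgue_measure (bad_letter M h) <= (6 / M%:R * (h 1 - h 0))%:E)%E.
Proof.
move=> M0 hm uv.
have M0' : 0 < M%:R :> R by rewrite ltr0n.
have L0 : 0 <= h 1 - h 0 by rewrite subr_ge0 (mob_le hm).
pose B : set R := \big[setU/set0]_(k < M) [set` `[h ((k.+1%:R + M%:R^-1)^-1), h (k.+1%:R^-1)]].
pose A : set R := [set` `[h 0, h (M%:R^-1)]].
apply: (@le_trans _ _ (lebesgue_measure A + lebesgue_measure B)%E).
  apply: measureU2; first exact: measurable_itv.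
  by apply: bigsetU_measurable => j _; exact: measurable_itv.
have -> : 6 / M%:R * (h 1 - h 0) = 2 / M%:R * (h 1 - h 0) + 4 / M%:R * (h 1 - h 0) by ring.
rewrite EFinD; apply: leeD.
  apply: lebesgue_measure_itv_le; first by rewrite mulr_ge0 ?divr_ge0.
  by have := mob_distortion hm uv (lexx 0) (_ : 0 <= M%:R^-1); rewrite subr0; apply; rewrite invr_ge0.
pose b (k : nat) : R := 4 / M%:R * (h 1 - h 0) * (k.+1%:R^-1 - k.+2%:R^-1).
apply: (@le_trans _ _ (\sum_(k < M) b k)%:E).
  apply: (@lebesgue_measure_bigsetU_le _ _ (fun k : nat =>
    [set` `[h ((k.+1%:R + M%:R^-1)^-1), h (k.+1%:R^-1)]])).
    by move=> k _; exact: measurable_itv.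
  move=> k _; rewrite /b -[k.+2]addn1 natrD; set x := k.+1%:R.
  have x1 : 1 <= x by rewrite ler1n.
  have x0 : 0 < x by lra.
  have X10 : 0 < x + 1 by lra.
  have mp : 0 < M%:R^-1 :> R by rewrite invr_gt0.
  have E1 : x^-1 - (x + 1)^-1 = (x * (x + 1))^-1.
    by field; rewrite !gt_eqF.
  have P0 : 0 <= x^-1 - (x + 1)^-1 by rewrite E1 invr_ge0 mulr_ge0 ?(ltW x0) ?(ltW X10).
  apply: lebesgue_measure_itv_le; first by rewrite mulr_ge0 // mulr_ge0 // divr_ge0.
  apply: le_trans (mob_distortion hm uv _ _) _.
  - by rewrite invr_ge0 addr_ge0 // ltW.
  - by rewrite lef_pV2 ?posrE ?addr_gt0 // lerDl ltW.
  rewrite [leRHS]mulrAC ler_wpM2r //.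
  have -> : 4 / M%:R * (x^-1 - (x + 1)^-1) = 2 * (2 / M%:R * (x^-1 - (x + 1)^-1)) by ring.
  rewrite ler_pM2l // E1.
  have xm0 : 0 < x + M%:R^-1 by rewrite addr_gt0.
  have -> : x^-1 - (x + M%:R^-1)^-1 = M%:R^-1 * (x * (x + M%:R^-1))^-1.
    by field; rewrite !gt_eqF // -?[x * _ + 1]addrC ltr_wpDr // mulr_gt0.
  rewrite [2 / _]mulrC -mulrA ler_pM2l //.
  rewrite -[leLHS]mul1r ler_pdivrMr ?mulr_gt0 // -mulrA mulrC -mulrA.
  rewrite [leRHS](_ : _ = 2 * (x * (x + M%:R^-1)) / (x * (x + 1))); last by ring.
  rewrite ler_pdivlMr ?mulr_gt0 // mul1r; nra.
rewrite lee_fin /b -mulr_sumr -[leRHS]mulr1 ler_wpM2l ?mulr_ge0 ?divr_ge0 //.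
pose f k : R := - (k.+1%:R^-1).
rewrite (eq_bigr (fun j : 'I_M => f j.+1 - f j)); last first.
  by move=> j _; rewrite /f opprK addrC.
rewrite -(big_mkord xpredT (fun j => f j.+1 - f j)) telescope_sumr // /f opprK invr1.
by rewrite gerDr oppr_le0 invr_ge0.
Qed.

(** Appending a letter yields a bottom row to which [mob_distortion] applies. *)
Lemma cf2_row_le (R : realType) (u v : R) l : (0 < l.1)%N -> (0 < l.2)%N ->
  0 <= u -> 0 <= v ->
  u + l.1%:R * v <= l.2%:R * u + (l.1%:R * l.2%:R + 1) * v.
Proof.
case: l => [a e] /=; rewrite -!(ler1n R) => a0 e0 u0 v0.
apply: lerD; first by rewrite ler_peMl.
by rewrite ler_wpM2r // -[leLHS]addr0 lerD // ler_peMr //; lra.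
Qed.

(** In every cylinder of depth k the bad part has relative length at most 6 / M (i + k), and by
    [sum_cf2_le] the cylinders have total length at most h 1 - h 0. *)
Lemma lebesgue_measure_bad_at (R : realType) (M : nat -> nat) k i (h : R -> R) u v :
  (forall n, (0 < M n)%N) -> mob h u v -> u <= v ->
  (lebesgue_measure (bad_at M k i h) <= (6 / (M (i + k)%N)%:R * (h 1 - h 0))%:E)%E.
Proof.
move=> M0; elim: k i h u v => [|k IH] i h u v hm uv /=.
  by rewrite addn0; exact: lebesgue_measure_bad_letter hm uv.
have [u0 v0 _] := hm.
pose b (a e : nat) := 6 / (M (i.+1 + k)%N)%:R *
  (h (cf2 (a.+1, e.+1) 1) - h (cf2 (a.+1, e.+1) 0)).
apply: (@le_trans _ _ (\sum_(a < M i) \sum_(e < M i) b a e)%:E).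
  apply: (@lebesgue_measure_bigsetU_le _ _ (fun a => \big[setU/set0]_(e < M i)
      bad_at M k i.+1 (h \o cf2 (a.+1, e.+1))) (fun a => \sum_(e < M i) b a e)) => a _.
    by apply: bigsetU_measurable => e _; exact: measurable_bad_at.
  apply: (@lebesgue_measure_bigsetU_le _ _ (fun e =>
      bad_at M k i.+1 (h \o cf2 (a.+1, e.+1)))) => e _; first exact: measurable_bad_at.
  apply: (IH _ _ _ _ (@mob_cf2 _ _ _ _ (a.+1, e.+1) isT isT hm)).
  by apply: (@cf2_row_le _ _ _ (a.+1, e.+1)) => //; exact: ltW.
rewrite lee_fin addnS -addSn /b.
under eq_bigr do rewrite -mulr_sumr; rewrite -mulr_sumr ler_wpM2l ?divr_ge0 //.
by apply: sum_cf2_le => y y'; exact: mob_le hm.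
Qed.

Definition cf2_letter (R : realType) (y : R) : nat * nat :=
  let a := Num.truncn y^-1 in (a, Num.truncn (y^-1 - a%:R)^-1).

(** Two steps of the Gauss map y -> 1/y - [1/y]. *)
Definition cf2_tail (R : realType) (y : R) : R :=
  let z := y^-1 - (Num.truncn y^-1)%:R in z^-1 - (Num.truncn z^-1)%:R.

Definition letter_le (M : nat) (l : nat * nat) : bool :=
  [&& 0 < l.1, l.1 <= M, 0 < l.2 & l.2 <= M]%N.

Lemma bad_letterP (R : realType) M (h : R -> R) u v y :
  (0 < M)%N -> mob h u v -> 0 <= y -> y < 1 -> ~ bad_letter M h (h y) ->
  [/\ letter_le M (cf2_letter y), 0 <= cf2_tail y, cf2_tail y < 1 &
      y = cf2 (cf2_letter y) (cf2_tail y)].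
Proof.
move=> M0 hm y0 y1 /not_orP[/= b1 b2].
have M0' : 0 < M%:R :> R by rewrite ltr0n.
have yM : M%:R^-1 < y.
  rewrite ltNge; apply/negP => yM; apply: b1; rewrite in_itv /=.
  by rewrite !(mob_le hm).
have yp : 0 < y by apply: lt_trans yM; rewrite invr_gt0.
rewrite /cf2_letter /cf2_tail /letter_le /cf2 /=; set a := Num.truncn y^-1; set z := y^-1 - a%:R.
have yV0 : 0 <= y^-1 by rewrite invr_ge0.
have /andP[aL aU] := truncn_itv yV0; rewrite -/a in aL aU.
have a0 : (0 < a)%N by rewrite truncn_gt0 -[leLHS]invr1 lef_pV2 ?posrE // ltW.
have aM : (a <= M)%N.
  rewrite -(ler_nat R); apply: le_trans aL _.
  by rewrite -[leRHS]invrK lef_pV2 ?posrE ?invr_gt0 // ltW.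
have zM : M%:R^-1 < z.
  rewrite ltNge; apply/negP => zM; apply: b2.
  have aM' : (a.-1 < M)%N by lia.
  rewrite -(bigcup_mkord M (fun k => [set` `[h ((k.+1%:R + M%:R^-1)^-1), h (k.+1%:R^-1)]])).
  exists a.-1 => //=; rewrite in_itv /= prednK //.
  have yE : y = (a%:R + z)^-1 by rewrite /z addrC subrK invrK.
  have z0 : 0 <= z by rewrite /z subr_ge0.
  have a0' : 0 < a%:R :> R by rewrite ltr0n.
  clearbody z; rewrite yE !(mob_le hm) ?invr_ge0 ?addr_ge0 ?ler0n //.
    by rewrite lef_pV2 ?posrE ?ltr_wpDr // lerDl.
  by rewrite lef_pV2 ?posrE ?ltr_wpDr ?invr_ge0 // lerD2l.
have zp : 0 < z by apply: lt_trans zM; rewrite invr_gt0.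
have z1 : z < 1 by rewrite /z ltrBlDl natr1.
have zV0 : 0 <= z^-1 by rewrite invr_ge0 ltW.
have /andP[eL eU] := truncn_itv zV0.
have e0 : (0 < Num.truncn z^-1)%N by rewrite truncn_gt0 -[leLHS]invr1 lef_pV2 ?posrE // ltW.
split.
- rewrite a0 aM e0 -(ler_nat R); apply: le_trans eL _.
  by rewrite -[leRHS]invrK lef_pV2 ?posrE ?invr_gt0 // ltW.
- by rewrite subr_ge0.
- by rewrite ltrBlDl natr1.
- by rewrite subrKC invrK subrKC invrK.
Qed.

(** The orbit is followed by absorbing the first letter into h and raising i by one. A tail that is
    bad at depth j then makes y bad at depth j + 1. *)
Lemma bad_at_orbit (R : realType) (M : nat -> nat) i (h : R -> R) u v y :
  (forall n, (0 < M n)%N) -> mob h u v -> 0 <= y -> y < 1 ->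
  (forall k, ~ bad_at M k i h (h y)) ->
  forall k, let yk := iter k (@cf2_tail R) y in
  [/\ letter_le (M (i + k)%N) (cf2_letter yk), 0 <= yk, yk < 1 &
      yk = cf2 (cf2_letter yk) (cf2_tail yk)].
Proof.
move=> M0 hm y0 y1 nb k; elim: k i h u v y hm y0 y1 nb => [|k IH] i h u v y hm y0 y1 nb.
  by have [] := bad_letterP (M0 i) hm y0 y1 (nb 0%N); rewrite addn0 /=; split.
have [lM t0 t1 yE] := bad_letterP (M0 i) hm y0 y1 (nb 0%N).
rewrite addnS -addSn iterSr.
move: lM => /and4P[a0 aM e0 eM].
apply: (IH i.+1 _ _ _ _ (mob_cf2 a0 e0 hm) t0 t1) => j /= bj.
apply: (nb j.+1) => /=; rewrite yE /=.
move: (cf2_letter y) a0 aM e0 eM bj {yE} => [a e] /= a0 aM e0 eM bj.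
rewrite -(bigcup_mkord (M i) (fun a =>
  \big[setU/set0]_(e < M i) bad_at M j i.+1 (h \o cf2 (a.+1, e.+1)))).
exists a.-1; first by move=> /=; lia.
rewrite -(bigcup_mkord (M i) (fun e => bad_at M j i.+1 (h \o cf2 (a.-1.+1, e.+1)))).
exists e.-1; first by move=> /=; lia.
by rewrite !prednK.
Qed.

(* The constant is chosen so that the bad intervals have total length at most
   6 / 12 = 1 / 2. *)
Definition letter_bound (n : nat) : nat := (12 * (n.+1 * n.+2))%N.

Definition tame (R : realType) : set R :=
  [set t | [/\ 0 <= t, t < 1 &
    forall k, let tk := iter k (@cf2_tail R) t in
    [/\ letter_le (letter_bound k) (cf2_letter tk), 0 <= tk, tk < 1 &
        tk = cf2 (cf2_letter tk) (cf2_tail tk)]]].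

(** Every point of [0, 1) outside the bad sets is tame. The bad sets have total measure at most 1/2,
    so a cover of the tame points carries the remaining 1/2. *)
Lemma tame_fat (R : realType) (c d : nat -> R) : (forall i, 0 <= d i) ->
  @tame R `<=` \bigcup_i [set` `[c i - d i, c i + d i]] ->
  ((2^-1)%:E <= \sum_(0 <= i <oo) (2 * d i)%:E)%E.
Proof.
move=> d0 cov.
pose A : set R := \bigcup_k bad_at letter_bound k 0 id.
pose B : set R := \bigcup_i [set` `[c i - d i, c i + d i]].
pose I : set R := [set` `[0, 1[].
have mA : measurable A by apply: bigcupT_measurable => k; exact: measurable_bad_at.
have mB : measurable B by apply: bigcupT_measurable => k; exact: measurable_itv.
have IAB : I `<=` A `|` B.
  move=> t; rewrite /I /= in_itv /= => /andP[t0 t1].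
  have [tA|tA] := pselect (A t); [by left|right; apply: cov].
  split=> //; apply: (@bad_at_orbit _ letter_bound 0 id 0 1) => //; first exact: mob_id.
  by move=> k bk; apply: tA; exists k.
have I1 : lebesgue_measure I = 1%E by rewrite lebesgue_measure_itv /= lte01 sube0.
have AL : (lebesgue_measure A <= (2^-1)%:E)%E.
  have mF k : measurable (bad_at letter_bound k 0 id : set R) by exact: measurable_bad_at.
  apply: (le_trans (@measure_sigma_subadditive _ _ _ (@lebesgue_measure R) A
    (fun k => bad_at letter_bound k 0 id) mF mA (@subset_refl _ A))).
  (* This is 6 / [letter_bound k], written as a difference so that the sum telescopes. *)
  pose b (k : nat) : R := 2^-1 * (k.+1%:R^-1 - k.+2%:R^-1).
  have bL k : (lebesgue_measure (bad_at letter_bound k 0 id : set R) <= (b k)%:E)%E.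
    apply: (le_trans (lebesgue_measure_bad_at _ _ _ (@mob_id R) _)) => //.
    rewrite lee_fin subr0 mulr1 add0n /b /letter_bound -[k.+2]addn1 !natrM natrD.
    have : 0 < k.+1%:R :> R by rewrite ltr0n.
    set x := k.+1%:R => x0.
    rewrite le_eqVlt; apply/orP; left; apply/eqP; field.
    by rewrite !gt_eqF // addr_gt0.
  apply: lime_le; first by apply: is_cvg_nneseries => n _ _; exact: measure_ge0.
  near=> n.
  apply: (@le_trans _ _ (\sum_(0 <= k < n) (b k)%:E)%E).
    by apply: lee_sum => k _; exact: bL.
  rewrite sumEFin lee_fin -mulr_sumr.
  pose f (k : nat) : R := - (k.+1%:R^-1).
  rewrite (eq_bigr (fun j => f j.+1 - f j)); last first.
    by move=> j _; rewrite /f opprK addrC.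
  rewrite telescope_sumr // /f opprK invr1 -[leRHS]mulr1.

  by rewrite ler_wpM2l ?invr_ge0 // gerDr oppr_le0 invr_ge0.
have BL : (lebesgue_measure B <= \sum_(0 <= i <oo) (2 * d i)%:E)%E.
  have mF k : measurable ([set` `[c k - d k, c k + d k]] : set R) by exact: measurable_itv.
  apply: (le_trans (@measure_sigma_subadditive _ _ _ (@lebesgue_measure R) B
    (fun k => [set` `[c k - d k, c k + d k]]) mF mB (@subset_refl _ B))).
  apply: lee_nneseries => [i _ _|i _]; first exact: measure_ge0.
  by apply: lebesgue_measure_itv_le; [rewrite mulr_ge0|lra].
apply: le_trans BL.
have H : (1 <= lebesgue_measure A + lebesgue_measure B)%E.
  rewrite -I1; apply: (@le_trans _ _ (lebesgue_measure (A `|` B))).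
    by apply: le_measure => //; rewrite inE; [exact: measurable_itv|exact: measurableU].
  exact: measureU2.
have : (1 <= (2^-1)%:E + lebesgue_measure B)%E by apply: le_trans H _; exact: leeD2r.
case: (lebesgue_measure B) => [x| |] //; rewrite ?leey // -EFinD !lee_fin => ?; lra.
Unshelve. all: by end_near.
Qed.

(** * Separation after insertion *)

Definition pos_letter (l : nat * nat) : bool := ((0 < l.1) && (0 < l.2))%N.

Definition cf2w (R : realType) (w : seq (nat * nat)) (y : R) : R := foldr (@cf2 R) y w.

Lemma cf2w_ge0 (R : realType) w (y : R) : 0 <= y -> 0 <= cf2w w y.
Proof. by move=> y0; elim: w => //= l w IH; exact: cf2_ge0. Qed.

Lemma cf2_mono (R : realType) l (y y' : R) : pos_letter l -> 0 <= y -> y <= y' ->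
  cf2 l y <= cf2 l y'.
Proof. by case/andP=> l1 l2; exact: mob_le (mob_cf2 l1 l2 (@mob_id R)). Qed.

Lemma cf2w_mono (R : realType) w (y y' : R) : all pos_letter w -> 0 <= y -> y <= y' ->
  cf2w w y <= cf2w w y'.
Proof.
move=> + y0 yy'; elim: w => //= l w IH /andP[lp wp].
by apply: cf2_mono => //; [exact: cf2w_ge0|exact: IH].
Qed.

Lemma cf2_in01 (R : realType) l (y : R) : pos_letter l -> 0 <= y -> 0 < cf2 l y < 1.
Proof.
case: l => a e /andP[/= a0 e0] y0; rewrite /cf2 /=.
have e0' : 0 < e%:R + y by rewrite ltr_wpDr // ltr0n.
have a1 : 1 <= a%:R :> R by rewrite ler1n.
have ie : 0 < (e%:R + y)^-1 by rewrite invr_gt0.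
by rewrite invr_gt0 invf_lt1; lra.
Qed.

Lemma cf2w_in01 (R : realType) w (y : R) : all pos_letter w -> w != [::] -> 0 <= y ->
  0 < cf2w w y < 1.
Proof.
by case: w => //= l w /andP[lp wp] _ y0; apply: cf2_in01 => //; exact: cf2w_ge0.
Qed.

Lemma cf2w_le1 (R : realType) w (y : R) : all pos_letter w -> 0 <= y <= 1 -> cf2w w y <= 1.
Proof.
case: w => [|l w] wp /andP[y0 y1] //.
by have /andP[_ /ltW] := cf2w_in01 wp isT y0.
Qed.

Lemma cvg_cf2w (R : realType) w (f : nat -> R) (z : R) : all pos_letter w ->
  0 <= z -> f m @[m --> \oo] --> z -> cf2w w (f m) @[m --> \oo] --> cf2w w z.
Proof.
move=> + z0 fz; elim: w => //= -[a e] w IH /andP[/andP[/= a0 e0] wp].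
rewrite -!(ltr0n R) in a0 e0.
have w0 := cf2w_ge0 w z0.
have ez : e%:R + cf2w w z != 0 by rewrite gt_eqF // ltr_wpDr.
have ez' : 0 <= (e%:R + cf2w w z)^-1 by rewrite invr_ge0 addr_ge0 // ltW.
apply: cvgV; first by rewrite gt_eqF //= ltr_wpDr.
apply: cvgD; first exact: cvg_cst.
by apply: cvgV => //; apply: cvgD; [exact: cvg_cst|exact: IH].
Qed.

Section Expansion.
Variables (R : realType) (W : nat -> seq (nat * nat)).
Hypothesis Wpos : forall n, all pos_letter (W n).
Hypothesis W0 : forall n, W n != [::].

Fixpoint convergent (m n : nat) : R :=
  if m is m'.+1 then cf2w (W n) (convergent m' n.+1) else 0.

Definition cf_value (n : nat) : R := limn (convergent ^~ n).

Lemma convergent_in01 m n : 0 <= convergent m n <= 1.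
Proof.
elim: m n => [|m IH] n /=; first by rewrite lexx ler01.
by have /andP[y0 y1] := IH n.+1; rewrite cf2w_ge0 //= cf2w_le1 // y0 y1.
Qed.

(** Words act as increasing maps, so replacing the truncation value 0 by a nonnegative tail raises
    the value. Monotone convergence then provides [cf_value] without any contraction estimate. *)
Lemma convergent_leS m n : convergent m n <= convergent m.+1 n.
Proof.
elim: m n => [|m IH] n; first by have /andP[] := convergent_in01 1 n.
by apply: cf2w_mono => //; have /andP[] := convergent_in01 m n.+1.
Qed.

Lemma cvg_convergent n : convergent m n @[m --> \oo] --> cf_value n.
Proof.
apply: nondecreasing_is_cvgn.
  by apply/nondecreasing_seqP => m; exact: convergent_leS.
by exists 1 => _ [m _ <-]; have /andP[] := convergent_in01 m n.
Qed.

Lemma cf_value_ge0 n : 0 <= cf_value n.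
Proof.
apply: limr_ge; first exact: cvg_convergent.
by apply: nearW => m; have /andP[] := convergent_in01 m n.
Qed.

Lemma cf_valueE n : cf_value n = cf2w (W n) (cf_value n.+1).
Proof.
have := cvg_cf2w (Wpos n) (cf_value_ge0 n.+1) (@cvg_convergent n.+1).
have := @cvg_convergent n; rewrite -cvg_shiftS => H1 H2.
exact: cvg_unique H1 H2.
Qed.

Lemma cf_value_in01 n : 0 < cf_value n < 1.
Proof. by rewrite cf_valueE cf2w_in01 // cf_value_ge0. Qed.

End Expansion.

Lemma inv_gap (R : realType) (M p p' : R) :
  0 < p -> 0 < p' -> p <= M -> p' <= M -> `|p - p'| / M ^+ 2 <= `|p^-1 - p'^-1|.
Proof.
move=> p0 p0' pM pM'.
have M0 : 0 < M by apply: lt_le_trans pM.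
have -> : p^-1 - p'^-1 = - ((p - p') / (p * p')) by field; rewrite !gt_eqF.
rewrite normrN normrM normfV (gtr0_norm (mulr_gt0 p0 p0')) ler_wpM2l //.
by rewrite lef_pV2 ?posrE ?exprn_gt0 ?mulr_gt0 // expr2 ler_pM // ltW.
Qed.

Lemma nat_gap (R : realType) (a a' : nat) (d z z' : R) :
  a != a' -> 0 <= z -> 0 <= z' -> z <= 1 - d -> z' <= 1 - d ->
  d <= `|(a%:R + z) - (a'%:R + z')|.
Proof.
have W : forall (a a' : nat) (z z' : R), (a < a')%N ->
    0 <= z -> 0 <= z' -> z <= 1 - d -> z' <= 1 - d ->
    d <= `|(a%:R + z) - (a'%:R + z')|.
  move=> b b' y y' bb y0 y0' y1 y1'.
  have : b.+1%:R <= b'%:R :> R by rewrite ler_nat.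
  by rewrite -natr1 => bb'; rewrite distrC; apply: le_trans (ler_norm _); lra.
rewrite neq_ltn => /orP[aa|aa] z0 z0' z1 z1'; first exact: W.
by rewrite distrC; exact: W.
Qed.

(** If the second entries differ while the first agree, then e + y and e' + y' are d apart, and each
    of the two inversions costs a factor (M + 1)^2. If the first entries differ, only the outer
    inversion matters, since 1 / (e + y) <= 1 / (1 + d) <= 1 - d / 2 keeps the fractional parts away
    from 1. *)
Lemma cf2_gap (R : realType) (M : nat) l l' (d y y' : R) :
  letter_le M l -> letter_le M l' -> l != l' -> 0 < d ->
  d <= y <= 1 - d -> d <= y' <= 1 - d ->
  d / (2 * M.+1%:R ^+ 4) <= `|cf2 l y - cf2 l' y'|.
Proof.
case: l l' => [a e] [a' e'] /and4P[/= a0 aM e0 eM] /and4P[/= a0' aM' e0' eM'].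
move=> ll d0 /andP[y0 y1] /andP[y0' y1'].
pose z : R := (e%:R + y)^-1; pose z' : R := (e'%:R + y')^-1.
have M1 : 1 <= M.+1%:R :> R by rewrite ler1n.
have le1 (b : nat) : (0 < b)%N -> 1 <= b%:R :> R by rewrite ler1n.
have leM (b : nat) : (b <= M)%N -> b%:R + 1 <= M.+1%:R :> R by move=> ?; rewrite -natr1 lerD2r ler_nat.
have zb (b : nat) (t : R) : (0 < b)%N -> d <= t -> t <= 1 - d ->
    0 <= (b%:R + t)^-1 <= 1 - d / 2.
  move=> b0 dt t1; have b1 := le1 _ b0; rewrite invr_ge0; apply/andP; split; first by lra.
  rewrite -[leLHS]div1r ler_pdivrMr; last by lra.
  nra.
have /andP[z0 z1] : 0 <= z <= 1 - d / 2 by exact: zb.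
have /andP[z0' z1'] : 0 <= z' <= 1 - d / 2 by exact: zb.
have A1 := le1 _ a0; have A1' := le1 _ a0'; have E1 := le1 _ e0; have E1' := le1 _ e0'.
have AM := leM _ aM; have AM' := leM _ aM'; have EM := leM _ eM; have EM' := leM _ eM'.
have M0 : 0 < M.+1%:R :> R by lra.
have G : `|(a%:R + z) - (a'%:R + z')| / M.+1%:R ^+ 2 <= `|cf2 (a, e) y - cf2 (a', e') y'|.
  by apply: inv_gap; lra.
apply: le_trans G.
have G2 : d / 2 / M.+1%:R ^+ 2 <= `|(a%:R + z) - (a'%:R + z')|.
  have [aa|aa] := eqVneq a a'; last first.
    apply: (@le_trans _ _ (d / 2)); last exact: nat_gap.
    by rewrite ler_pdivrMr ?exprn_gt0 // ler_peMr ?exprn_ege1 // divr_ge0 // ltW.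
  have -> : a%:R + z - (a'%:R + z') = z - z' by rewrite -aa; ring.
  have ee : e != e' by apply: contraNneq ll => ->; rewrite aa.
  apply: (@le_trans _ _ (`|(e%:R + y) - (e'%:R + y')| / M.+1%:R ^+ 2)); last first.
    by apply: inv_gap; lra.
  rewrite ler_wpM2r ?invr_ge0 ?exprn_ge0 ?(ltW M0) //.
  by apply: (@le_trans _ _ d); [lra|apply: nat_gap => //; lra].
rewrite ler_pdivlMr ?exprn_gt0 //; apply: le_trans G2.
rewrite le_eqVlt; apply/orP; left; apply/eqP; field; exact: lt0r_neq0.
Qed.

(** Supplies the margin d required by [cf2_gap]. The extreme values are 1 / (M + 1) and 1 / (1 + 1 /
    (M + 1)) = 1 - 1 / (M + 2). *)
Lemma cf2_margin (R : realType) (M : nat) l (y : R) :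
  letter_le M l -> 0 <= y <= 1 -> M.+2%:R^-1 <= cf2 l y <= 1 - M.+2%:R^-1.
Proof.
case: l => [a e] /and4P[/= a0 aM e0 eM] /andP[y0 y1]; rewrite /cf2 /=.
have le1 (b : nat) : (0 < b)%N -> 1 <= b%:R :> R by rewrite ler1n.
have A1 := le1 _ a0; have E1 := le1 _ e0.
have -> : M.+2%:R = M%:R + 2 :> R by rewrite -addn2 natrD.
rewrite -!(ler_nat R) in aM eM.
set z := (e%:R + y)^-1.
have z1 : z <= 1 by rewrite invf_le1; lra.
have z0 : (e%:R + 1)^-1 <= z by rewrite lef_pV2 ?posrE; lra.
have z0' : 0 < (e%:R + 1)^-1 :> R by rewrite invr_gt0; lra.
apply/andP; split; first by rewrite lef_pV2 ?posrE; lra.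
have -> : 1 - (M%:R + 2)^-1 = (1 + (M%:R + 1)^-1)^-1 :> R.
  have M0 : 0 <= M%:R :> R by [].
  by field; do ?[apply/andP; split]; apply: lt0r_neq0; lra.
rewrite lef_pV2 ?posrE ?ltr_wpDr ?invr_ge0 ?lerD //; try lra.
by apply: le_trans z0; rewrite lef_pV2 ?posrE; lra.
Qed.

Definition stage (ins : nat -> option (nat * nat)) (l : nat -> nat * nat) (n : nat) :=
  l n :: seq_of_opt (ins n).

(* Inserting a letter after the n-th one multiplies both denominators by at most this
   factor, because the second denominator is then at most [letter_bound n + 1] times the
   first. *)
Definition ins_cost (ins : nat -> option (nat * nat)) (n : nat) : nat :=
  if ins n is Some i then (i.1.+1 * i.2.+1 * (letter_bound n).+1)%N else 1%N.

Lemma ins_cost_gt0 ins n : (0 < ins_cost ins n)%N.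
Proof. by rewrite /ins_cost; case: (ins n). Qed.

(** Here h composes the common letters alone and g composes them with the insertions. A common
    letter multiplies both bottom rows by the same nonnegative matrix, which preserves an entrywise
    bound, and an insertion is paid for by [ins_cost]. The entry v at least doubles at each letter
    because a e + 1 >= 2. *)
Lemma common_prefix (R : realType) ins (l l' : nat -> nat * nat) (t t' x x' : nat -> R) n :
  (forall k i, ins k = Some i -> pos_letter i) ->
  (forall k, letter_le (letter_bound k) (l k)) ->
  (forall k, t k = cf2 (l k) (t k.+1)) -> (forall k, t' k = cf2 (l' k) (t' k.+1)) ->
  (forall k, x k = cf2w (stage ins l k) (x k.+1)) ->
  (forall k, x' k = cf2w (stage ins l' k) (x' k.+1)) ->
  (forall k, (k < n)%N -> l k = l' k) ->
  exists h g u v u' v',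
    [/\ mob h u v, mob g u' v', u <= v, 2 ^+ n <= v &
        u' <= (\prod_(k < n) ins_cost ins k)%:R * u /\
        v' <= (\prod_(k < n) ins_cost ins k)%:R * v] /\
    [/\ t 0%N = h (t n), t' 0%N = h (t' n), x 0%N = g (x n) & x' 0%N = g (x' n)].
Proof.
move=> insP lb tE t'E xE x'E; elim: n => [|n IH] ll.
  exists id, id, 0, 1, 0, 1; rewrite !big_ord0 mul1r mulr1; split; split=> //.
  - exact: mob_id.
  - exact: mob_id.
have [|h [g [u [v [u' [v' [[hm gm uv vn [u'D v'D]] [th t'h xg x'g]]]]]]]] := IH.
  by move=> k kn; apply: ll; lia.
have ln := ll _ (ltnSn n).
have lbn := lb n; have tn := tE n; have t'n := t'E n; have xn := xE n; have x'n := x'E n.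
rewrite /stage -ln in t'n x'n xn; move: (l n) lbn tn t'n xn x'n => [a e] lbn tn t'n xn x'n.
case/and4P: lbn => /= a0 aM e0 eM.
have [u0 v0 _] := hm; have [u'0 v'0 _] := gm.
have hm1 := @mob_cf2 _ _ _ _ (a, e) a0 e0 hm; have gm1 := @mob_cf2 _ _ _ _ (a, e) a0 e0 gm.
rewrite /= in hm1 gm1.
have A1 : 1 <= a%:R :> R by rewrite ler1n.
have E1 : 1 <= e%:R :> R by rewrite ler1n.
set D : R := (\prod_(k < n) ins_cost ins k)%:R in u'D v'D.
have D0 : 0 <= D by [].
have uv1 := @cf2_row_le _ u v (a, e) a0 e0 u0 (ltW v0); rewrite /= in uv1.
have v2 : 2 ^+ n.+1 <= e%:R * u + (a%:R * e%:R + 1) * v.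
  have ae1 : 1 <= a%:R * e%:R :> R by rewrite mulr_ege1.
  have : 2 * v <= (a%:R * e%:R + 1) * v by rewrite ler_wpM2r ?(ltW v0) //; lra.
  have : 0 <= e%:R * u by rewrite mulr_ge0.
  by rewrite exprS; lra.
have uD1 : u' + a%:R * v' <= D * (u + a%:R * v).
  by rewrite mulrDr mulrCA; apply: lerD => //; apply: ler_wpM2l.
have vD1 : e%:R * u' + (a%:R * e%:R + 1) * v' <= D * (e%:R * u + (a%:R * e%:R + 1) * v).
  by rewrite mulrDr !(mulrCA D); apply: lerD; apply: ler_wpM2l; rewrite ?addr_ge0 ?mulr_ge0.
have bnd : e%:R * u + (a%:R * e%:R + 1) * v <= ((letter_bound n).+1)%:R * (u + a%:R * v).
  have : e%:R + 1 <= (letter_bound n).+1%:R :> R by rewrite -natr1 lerD2r ler_nat.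
  have av : v <= a%:R * v by rewrite ler_peMl // ltW.
  move=> eb; apply: (@le_trans _ _ ((e%:R + 1) * (u + a%:R * v))); first by lra.
  by rewrite ler_wpM2r // addr_ge0 // mulr_ge0 // ltW.
rewrite big_ord_recr /= natrM -/D /ins_cost.
set U := u + _ in hm1 uv1 uD1 bnd; set V := e%:R * u + _ in hm1 uv1 v2 vD1 bnd.
set U' := u' + _ in gm1 uD1; set V' := e%:R * u' + _ in gm1 vD1.
case insn : (ins n) => [[b f]|]; last first.
  exists (h \o cf2 (a, e)), (g \o cf2 (a, e)), U, V, U', V'.
  rewrite mulr1; split; split=> //=; rewrite insn /= in xn x'n.
  - by rewrite -tn.
  - by rewrite -t'n.
  - by rewrite -xn.
  - by rewrite -x'n.
have /andP[/= b0 f0] := insP _ _ insn.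
have gm2 := @mob_cf2 _ _ _ _ (b, f) b0 f0 gm1; rewrite /= in gm2.
exists (h \o cf2 (a, e)), ((g \o cf2 (a, e)) \o cf2 (b, f)), U, V.
exists (U' + b%:R * V'), (f%:R * U' + (b%:R * f%:R + 1) * V').
rewrite insn /= in xn x'n.
split; split=> //=; last 4 first.
- by rewrite -tn.
- by rewrite -t'n.
- by rewrite -xn.
- by rewrite -x'n.
have B1 : 1 <= b%:R :> R by rewrite ler1n.
have F1 : 1 <= f%:R :> R by rewrite ler1n.
have [U0 V0 _] := hm1.
rewrite !natrM -[b.+1%:R]natr1 -[f.+1%:R]natr1.
set L := (letter_bound n).+1%:R in bnd *.
have L1 : 1 <= L by rewrite ler1n.
have BV : b%:R * V' <= b%:R * (D * V) by rewrite ler_wpM2l.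
have DV : D * V <= D * (L * U) by rewrite ler_wpM2l.
have DU0 : 0 <= D * U by rewrite mulr_ge0.
have DV0 : 0 <= D * V by rewrite mulr_ge0 // ltW.
have DUV : D * U <= D * V by rewrite ler_wpM2l.
split.
  apply: (@le_trans _ _ ((1 + b%:R * L) * (D * U))); first by nra.
  rewrite [leRHS](_ : _ = (b%:R + 1) * L * (f%:R + 1) * (D * U)); last by ring.
  apply: ler_wpM2r => //; apply: (@le_trans _ _ ((b%:R + 1) * L)); first by lra.
  by rewrite ler_peMr ?mulr_ge0 //; lra.
apply: (@le_trans _ _ ((f%:R + b%:R * f%:R + 1) * (D * V))); first by nra.
rewrite [leRHS](_ : _ = (b%:R + 1) * (f%:R + 1) * L * (D * V)); last by ring.
apply: ler_wpM2r => //; apply: (@le_trans _ _ ((b%:R + 1) * (f%:R + 1))); first by lra.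
by rewrite ler_peMr ?mulr_ge0 //; lra.
Qed.

Lemma letter_leW M M' l : (M <= M')%N -> letter_le M l -> letter_le M' l.
Proof.
move=> MM /and4P[? H1 ? H2].
by apply/and4P; split=> //; [exact: leq_trans H1 MM|exact: leq_trans H2 MM].
Qed.

Lemma letter_le_pos M l : letter_le M l -> pos_letter l.
Proof. by move=> /and4P[? _ ? _]; apply/andP. Qed.

Lemma mob_dist_le (R : realType) (h : R -> R) u v y y' :
  mob h u v -> 0 <= y <= 1 -> 0 <= y' <= 1 -> `|h y - h y'| <= (v ^+ 2)^-1.
Proof.
move=> [u0 v0 hE] /andP[a0 a1] /andP[b0 b1].
have v20 : 0 < v ^+ 2 by rewrite exprn_gt0.
have P : v ^+ 2 <= (u * y + v) * (u * y' + v).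
  by rewrite expr2 ler_pM ?(ltW v0) // lerDr mulr_ge0.
have := congr1 Num.norm (hE _ _ a0 b0).
rewrite normrM [X in _ * X]gtr0_norm; last exact: lt_le_trans P.
move=> E2; rewrite -[leRHS]mul1r ler_pdivlMr //.
apply: (@le_trans _ _ `|y - y'|); first by rewrite -E2 ler_wpM2l.
by rewrite ler_norml; apply/andP; split; lra.
Qed.

(** The denominators of g contribute 4 D^2, with D the product of the costs, and [cf2_gap] with
    margin 1 / (M n + 2) contributes 2 (M n + 2)^5. *)
Definition separation (ins : nat -> option (nat * nat)) (M : nat -> nat) (n : nat) : nat :=
  (8 * (\prod_(k < n) ins_cost ins k) ^ 2 * (M n).+2 ^ 5)%N.

(** At the first disagreement n, both distances are compared with the same v: the one of t, t' from
    above through h, and the one of x, x' from below through g and the gap between the distinct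
    letters. *)
Lemma insertion_separation (R : realType) ins (M : nat -> nat) (l l' : nat -> nat * nat)
    (t t' x x' : nat -> R) n :
  (forall k, letter_bound k <= M k)%N -> (forall k, letter_bound k.+1 <= M k)%N ->
  (forall k i, ins k = Some i -> letter_le (M k) i) ->
  (forall k, letter_le (letter_bound k) (l k)) ->
  (forall k, letter_le (letter_bound k) (l' k)) ->
  (forall k, 0 <= t k <= 1) -> (forall k, 0 <= t' k <= 1) ->
  (forall k, 0 <= x k <= 1) -> (forall k, 0 <= x' k <= 1) ->
  (forall k, t k = cf2 (l k) (t k.+1)) -> (forall k, t' k = cf2 (l' k) (t' k.+1)) ->
  (forall k, x k = cf2w (stage ins l k) (x k.+1)) ->
  (forall k, x' k = cf2w (stage ins l' k) (x' k.+1)) ->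
  (forall k, (k < n)%N -> l k = l' k) -> l n != l' n ->
  exists2 v : R, 2 ^+ n <= v &
    `|t 0%N - t' 0%N| <= (v ^+ 2)^-1 /\
    ((separation ins M n)%:R * v ^+ 2)^-1 <= `|x 0%N - x' 0%N|.
Proof.
move=> M0 M1 insM lb lb' t01 t01' x01 x01' tE t'E xE x'E ll lln.
have insP k i : ins k = Some i -> pos_letter i.
  by move=> /insM /letter_le_pos.
have [h [g [u [v [u' [v' [[hm gm uv vn [u'D v'D]] [th t'h xg x'g]]]]]]]] :=
  common_prefix insP lb tE t'E xE x'E ll.
exists v => //.
set D : R := (\prod_(k < n) ins_cost ins k)%:R in u'D v'D.
have D1 : 1 <= D by rewrite ler1n prodn_gt0 // => k; exact: ins_cost_gt0.
have [u0 v0 hE] := hm; have [u'0 v'0 gE] := gm.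
have v20 : 0 < v ^+ 2 by rewrite exprn_gt0.
split; first by rewrite th t'h; apply: mob_dist_le hm _ _.
have /andP[a0 a1] := x01 n; have /andP[b0 b1] := x01' n.
have E := gE _ _ a0 b0; rewrite -xg -x'g in E.
set P := (u' * x n + v') * (u' * x' n + v') in E.
have Pp : 0 < P by rewrite mulr_gt0 // ltr_wpDl // mulr_ge0.
have B (y : R) : 0 <= y -> y <= 1 -> u' * y + v' <= 2 * D * v.
  move=> y0 y1; apply: (@le_trans _ _ (D * u + D * v)); last first.
    have : D * u <= D * v by rewrite ler_wpM2l //; lra.
    by lra.
  by rewrite lerD //; apply: le_trans u'D; rewrite ler_piMr.
have PB : P <= 4 * D ^+ 2 * v ^+ 2.
  rewrite (_ : 4 * D ^+ 2 * v ^+ 2 = (2 * D * v) * (2 * D * v)); last by ring.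
  by rewrite ler_pM ?B // ltW // ltr_wpDl // mulr_ge0.
have := congr1 Num.norm E; rewrite normrM [X in _ * X]gtr0_norm // => E2.

(* The letter following [m n] is the inserted one if there is one, and otherwise [m n.+1]. This is
   why M n has to dominate [letter_bound n.+1]. *)
have margin (m : nat -> nat * nat) (y : nat -> R) : (forall k, letter_le (letter_bound k) (m k)) ->
    (forall k, 0 <= y k <= 1) -> (forall k, y k = cf2w (stage ins m k) (y k.+1)) ->
    (M n).+2%:R^-1 <= cf2w (seq_of_opt (ins n)) (y n.+1) <= 1 - (M n).+2%:R^-1.
  move=> mb y01 yE; case insn : (ins n) => [i|] /=.
    by apply: cf2_margin => //; exact: insM insn.
  rewrite yE /=; apply: cf2_margin; first exact: letter_leW (M1 n) (mb _).
  have /andP[y0 y1] := y01 n.+2.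
  rewrite cf2w_ge0 //= cf2w_le1 ?y0 ?y1 //.
  by case insn1 : (ins n.+1) => [i|] //=; rewrite (insP _ _ insn1).
have M20 : 0 < (M n).+2%:R^-1 :> R by rewrite invr_gt0.
have G := cf2_gap (letter_leW (M0 n) (lb n)) (letter_leW (M0 n) (lb' n)) lln M20
  (margin _ _ lb x01 xE) (margin _ _ lb' x01' x'E).
have xn : x n = cf2 (l n) (cf2w (seq_of_opt (ins n)) (x n.+1)) := xE n.
have x'n : x' n = cf2 (l' n) (cf2w (seq_of_opt (ins n)) (x' n.+1)) := x'E n.
rewrite -xn -x'n -E2 in G.
rewrite -[leLHS]div1r ler_pdivrMr ?mulr_gt0 ?ltr0n
  /separation ?muln_gt0 ?expn_gt0 ?prodn_gt0 //=; last first.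
  by move=> k; exact: ins_cost_gt0.
rewrite (natrM _ (8 * _)%N) (natrM _ 8%N) !natrX -/D.
set m := (M n).+2%:R in G *.
have m1 : 1 <= m by rewrite ler1n.
have mm : (M n).+1%:R ^+ 4 <= m ^+ 4 by rewrite lerXn2r ?nnegrE ?ler_nat.
have G1 : m^-1 / (2 * m ^+ 4) <= m^-1 / (2 * (M n).+1%:R ^+ 4).
  by rewrite ler_wpM2l ?invr_ge0 // lef_pV2 ?posrE ?mulr_gt0 ?exprn_gt0 // ?ler_pM2l.
have m0 : m != 0 by rewrite gt_eqF // (lt_le_trans ltr01).
have G2 := le_trans G1 G.
rewrite [leLHS](_ : 1 = (m^-1 / (2 * m ^+ 4)) * (2 * m ^+ 5)); last by field.
apply: (@le_trans _ _ (`|x 0%N - x' 0%N| * P * (2 * m ^+ 5))).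
  by rewrite ler_wpM2r // mulr_ge0 // exprn_ge0 // (le_trans ler01).
rewrite -mulrA; apply: ler_wpM2l => //.
rewrite [leRHS](_ : _ = 4 * D ^+ 2 * v ^+ 2 * (2 * m ^+ 5)); last by ring.
by rewrite ler_wpM2r // mulr_ge0 // exprn_ge0 // (le_trans ler01).
Qed.

Lemma separation_gt0 ins M n : (0 < separation ins M n)%N.
Proof.
rewrite /separation muln_gt0 expn_gt0 andbT muln_gt0 expn_gt0 prodn_gt0 //.
by move=> k; exact: ins_cost_gt0.
Qed.

(** Let S be the separation at the first disagreement n. Since v >= 2^n, S^s <= S <= K 4^((1 - s) n)
    <= K v^(2 (1 - s)), hence v^(-2) <= K (S v^2)^(-s). *)
Lemma insertion_holder (R : realType) ins (M : nat -> nat) (l l' : nat -> nat * nat)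
    (t t' x x' : nat -> R) (s K : R) :
  (forall k, letter_bound k <= M k)%N -> (forall k, letter_bound k.+1 <= M k)%N ->
  (forall k i, ins k = Some i -> letter_le (M k) i) ->
  (forall k, letter_le (letter_bound k) (l k)) ->
  (forall k, letter_le (letter_bound k) (l' k)) ->
  (forall k, 0 <= t k <= 1) -> (forall k, 0 <= t' k <= 1) ->
  (forall k, 0 <= x k <= 1) -> (forall k, 0 <= x' k <= 1) ->
  (forall k, t k = cf2 (l k) (t k.+1)) -> (forall k, t' k = cf2 (l' k) (t' k.+1)) ->
  (forall k, x k = cf2w (stage ins l k) (x k.+1)) ->
  (forall k, x' k = cf2w (stage ins l' k) (x' k.+1)) ->
  0 <= s -> s < 1 -> 0 <= K ->
  (forall n, (separation ins M n)%:R <= K * (4 `^ (1 - s)) ^+ n) ->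
  `|t 0%N - t' 0%N| <= K * `|x 0%N - x' 0%N| `^ s.
Proof.
move=> M0 M1 insM lb lb' t01 t01' x01 x01' tE t'E xE x'E s0 s1 K0 sK.
have [ex|nex] := pselect (exists n, l n != l' n); last first.
  have insP k i : ins k = Some i -> pos_letter i.
    by move=> /insM /and4P[? _ ? _]; apply/andP.
  suff -> : `|t 0%N - t' 0%N| = 0 by rewrite mulr_ge0 ?powR_ge0.
  apply/eqP; rewrite -[_ == _]negbK; apply/negP => d0.
  have {}d0 : 0 < `|t 0%N - t' 0%N| by rewrite lt_def d0 /=.
  have ll k : l k = l' k.
    by apply/eqP/negPn/negP => lk; apply: nex; exists k.
  (* Without a disagreement t and t' coincide: agreement in n + 1 letters forces v > n + 1, hence a
     distance below the assumed one. *)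
  pose n := Num.truncn `|t 0%N - t' 0%N|^-1.
  have [h [g [u [v [u' [v' [[hm gm uv vn _] [th t'h _ _]]]]]]]] :=
    common_prefix insP lb tE t'E xE x'E (fun k (_ : (k < n.+1)%N) => ll k).
  have [_ v0 _] := hm.
  have := mob_dist_le hm (t01 n.+1) (t01' n.+1); rewrite -th -t'h.
  rewrite leNgt => /negP; apply.
  have v1 : n.+1%:R < v.
    by apply: lt_le_trans vn; rewrite -natrX ltr_nat ltn_expl.
  have n1 : 1 <= n.+1%:R :> R by rewrite ler1n.
  rewrite -[ltRHS]invrK ltf_pV2 ?posrE ?exprn_gt0 ?invr_gt0 //.
  by apply: (lt_trans (truncnS_gt _)); rewrite -/n expr2; nra.
have nP := ex_minnP ex; case: nP => n ln nmin.
have ll k : (k < n)%N -> l k = l' k.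
  by move=> kn; apply/eqP/negPn/negP => /nmin; rewrite leqNgt kn.
have [v vn [tv xv]] := insertion_separation M0 M1 insM lb lb' t01 t01' x01 x01' tE t'E xE x'E ll ln.
apply: le_trans tv _.
have v0 : 0 < v by apply: lt_le_trans vn; rewrite exprn_gt0.
set S : R := (separation ins M n)%:R in xv.
have S1 : 1 <= S by rewrite ler1n separation_gt0.
have Sv0 : 0 < S * v ^+ 2 by rewrite mulr_gt0 ?exprn_gt0 //; lra.
apply: (@le_trans _ _ (K * ((S * v ^+ 2)^-1) `^ s)); last first.
  by rewrite ler_wpM2l // ge0_ler_powR ?nnegrE // ?invr_ge0 ltW.
rewrite -[X in X `^ s]powR_inv1 ?(ltW Sv0) // -powRrM mulN1r powRN -[leLHS]mul1r.
rewrite ler_pdivlMr ?powR_gt0 // mulrAC ler_pdivrMr ?exprn_gt0 // mul1r.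
have S0 : 0 <= S by lra.
have v20 : 0 <= v ^+ 2 by rewrite exprn_ge0 // ltW.
rewrite powRM //.
have Ss : S `^ s <= S by rewrite -[leRHS]powRr1 ?ler_powR //; lra.
have V : (4 `^ (1 - s)) ^+ n <= (v ^+ 2) `^ (1 - s).
  rewrite -powR_mulrn ?powR_ge0 // -powRrM mulrC powRrM powR_mulrn //
    ge0_ler_powR ?nnegrE ?exprn_ge0 //; try lra.
  rewrite (_ : 4 = 2 ^+ 2); last by ring.
  by rewrite -exprM mulnC exprM lerXn2r ?nnegrE ?exprn_ge0 // ltW.
have V2 : v ^+ 2 = (v ^+ 2) `^ (1 - s) * (v ^+ 2) `^ s.
  rewrite -powRD ?subrK ?powRr1 //.
  by rewrite oner_eq0.
rewrite [X in _ <= K * X]V2 mulrA ler_wpM2r ?powR_ge0 //.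
apply: (le_trans Ss); apply: (le_trans (sK n)).
by rewrite ler_wpM2l.
Qed.

(** * Backward continued fraction digits *)

(** Two steps of the Euclidean algorithm on (d, c): the tail y is the quotient of the remainders c -
    e d' and d' = d - a c. *)
Lemma cf2_denominator (R : realType) l (y : R) (c d : nat) :
  pos_letter l -> 0 < y < 1 -> cf2 l y * d%:R = c%:R -> (0 < d)%N ->
  exists c' d', [/\ y * d'%:R = c'%:R, (0 < d')%N & (d' < d)%N].
Proof.
case: l => [a e] /andP[/= a0 e0] /andP[y0 y1] H d0.
have a1 : 1 <= a%:R :> R by rewrite ler1n.
have e1 : 1 <= e%:R :> R by rewrite ler1n.
have d0' : 0 < d%:R :> R by rewrite ltr0n.
pose z : R := (e%:R + y)^-1.
have z0 : 0 < z by rewrite invr_gt0; lra.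
have z1 : z < 1 by rewrite invf_lt1; lra.
have H1 : d%:R = (a%:R + z) * c%:R by rewrite -H /cf2 /= -/z mulrA mulfV ?mul1r //; lra.
have c0 : 0 < c%:R :> R by rewrite -H mulr_gt0 // /cf2 /= -/z invr_gt0; lra.
have acd : (a * c <= d)%N.
  by rewrite -(ler_nat R) natrM H1 mulrDl lerDl mulr_ge0 // ltW.
pose d' := (d - a * c)%N.
have d'E : d'%:R = z * c%:R by rewrite natrB // natrM H1; ring.
clearbody d'.
have cE : c%:R = (e%:R + y) * d'%:R by rewrite d'E mulrA mulfV ?mul1r //; lra.
have edc : (e * d' <= c)%N.
  by rewrite -(ler_nat R) natrM cE mulrDl lerDl mulr_ge0 // ltW.
have d'0 : 0 < d'%:R :> R by rewrite d'E mulr_gt0.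
exists (c - e * d')%N, d'; split.
- by rewrite natrB // natrM cE; ring.
- by rewrite -(ltr0n R).
- by rewrite -(ltr_nat R) d'E H1 ltr_pM2r //; lra.
Qed.

Lemma cf2w_denominator (R : realType) w (y : R) (c d : nat) :
  all pos_letter w -> w != [::] -> 0 < y < 1 -> cf2w w y * d%:R = c%:R -> (0 < d)%N ->
  exists c' d', [/\ y * d'%:R = c'%:R, (0 < d')%N & (d' < d)%N].
Proof.
move=> + + y01; elim: w c d => //= l w IH c d /andP[lp wp] _ H d0.
have [w0|wn] := eqVneq w [::].
  by rewrite w0 /= in H; exact: cf2_denominator lp y01 H d0.
have [y0 y1] := andP y01.
have [c' [d' [H' d'0 d'd]]] := cf2_denominator lp (cf2w_in01 wp wn (ltW y0)) H d0.
have [c2 [d2 [H2 d20 d2d]]] := IH _ _ wp wn H' d'0.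
by exists c2, d2; split=> //; exact: ltn_trans d2d d'd.
Qed.

(** Infinite descent on the denominator along the successive tails. *)
Lemma cf_expansion_irrational (R : realType) (W : nat -> seq (nat * nat)) (x : nat -> R) :
  (forall n, all pos_letter (W n)) -> (forall n, W n != [::]) ->
  (forall n, 0 < x n < 1) -> (forall n, x n = cf2w (W n) (x n.+1)) ->
  irrational (x 0%N).
Proof.
move=> Wp W0 x01 xE [q _ qx].
suff H : forall d c n, (0 < d)%N -> x n * d%:R = c%:R -> False.
  have /andP[x0 _] := x01 0%N.
  have E : x 0%N * (`|denq q|%N)%:R = (numq q)%:~R.
    rewrite -qx /ratr natr_absz ger0_norm ?denq_ge0 // divfK //.
    by rewrite intr_eq0 denq_neq0.
  have d0 : (0 < `|denq q|)%N by rewrite absz_gt0 denq_neq0.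
  apply: (H _ `|numq q|%N 0%N d0); rewrite E natr_absz ger0_norm //.
  by rewrite -(ler0z R) -E mulr_ge0 // ltW.
elim/ltn_ind => d IH c n d0 H; rewrite xE in H.
have [c' [d' [H' d'0 d'd]]] := cf2w_denominator (Wp n) (W0 n) (x01 n.+1) H d0.
exact: IH d'd _ _ d'0 H'.
Qed.

Definition digit (R : realType) (x : R) : int := Num.floor (1 - x)^-1 + 1.

Lemma renyi_in01 (R : realType) (x : R) : 0 <= renyi x < 1.
Proof.
rewrite /renyi; set y := (1 - x)^-1.
by rewrite subr_ge0 floor_le_tmp //= ltrBlDl -[X in _ + X]/(1%:~R) -intrD floorD1_gt.
Qed.

(** For x = 1 / (a + z) one has 1 / (1 - x) = 1 + 1 / (a - 1 + z). If a >= 2 this lies between 1 and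
    2, so the digit is 2 and the Renyi map lowers a by one. If a = 1 it equals 1 + e + y, the case
    of [digit_cf2_1]. *)
Lemma digit_cf2 (R : realType) a e (y : R) : (0 < e)%N -> 0 <= y < 1 ->
  digit (cf2 (a.+2, e) y) = 2 /\ renyi (cf2 (a.+2, e) y) = cf2 (a.+1, e) y.
Proof.
move=> e0 /andP[y0 y1].
have e1 : 1 <= e%:R :> R by rewrite ler1n.
rewrite /digit /renyi /cf2 /=; set z := (e%:R + y)^-1.
have z0 : 0 < z by rewrite invr_gt0; lra.
rewrite -[a.+2%:R]natr1; set b := a.+1%:R.
have b1 : 1 <= b :> R by rewrite ler1n.
have -> : (1 - (b + 1 + z)^-1)^-1 = 1 + (b + z)^-1.
  by field; do ?[apply/andP; split]; apply: lt0r_neq0; lra.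
have i0 : 0 < (b + z)^-1 by rewrite invr_gt0; lra.
have i1 : (b + z)^-1 < 1 by rewrite invf_lt1; lra.
have -> : Num.floor (1 + (b + z)^-1) = 1.
  by apply: floor_def; rewrite -[1 + 1]/(2%:Z) /=; apply/andP; split; lra.
by split=> //; rewrite addrC addrA addNr add0r.
Qed.

Lemma digit_cf2_1 (R : realType) e (y : R) : (0 < e)%N -> 0 <= y < 1 ->
  digit (cf2 (1%N, e) y) = e.+2%:Z /\ renyi (cf2 (1%N, e) y) = y.
Proof.
move=> e0 /andP[y0 y1].
have e1 : 1 <= e%:R :> R by rewrite ler1n.
rewrite /digit /renyi /cf2 /=; set z := (e%:R + y)^-1.
have z0 : 0 < z by rewrite invr_gt0; lra.
have -> : (1 - (1 + z)^-1)^-1 = e.+1%:R + y.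
  rewrite -natr1 (_ : (1 - (1 + z)^-1)^-1 = z^-1 + 1); first by rewrite /z invrK; ring.
  by field; do ?[apply/andP; split]; apply: lt0r_neq0; lra.
have -> : Num.floor (e.+1%:R + y) = e.+1%:Z.
  by apply: floor_def; rewrite intrD !pmulrn; apply/andP; split; lra.
by split; [rewrite -PoszD addn1|rewrite -pmulrn; ring].
Qed.

Definition digit_sum (R : realType) (f : int -> R) (x : R) (m : nat) : R :=
  \sum_(k < m) f (digit (iter k (@renyi R) x)).

Lemma digit_sumD (R : realType) (f : int -> R) x m n :
  digit_sum f x (m + n) = digit_sum f x m + digit_sum f (iter m (@renyi R) x) n.
Proof.
rewrite /digit_sum big_split_ord /=; congr (_ + _).
by apply: eq_bigr => i _; rewrite addnC iterD.
Qed.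

Definition word_length (w : seq (nat * nat)) : nat := \sum_(l <- w) l.1.

(** Meant for f vanishing at 2, so that the runs of digits 2 contribute nothing. *)
Definition word_sum (R : realType) (f : int -> R) (w : seq (nat * nat)) : R :=
  \sum_(l <- w) f (l.2.+2%:Z).

Lemma digit_sum_cf2 (R : realType) (f : int -> R) l (y : R) :
  f 2 = 0 -> pos_letter l -> 0 <= y < 1 ->
  iter l.1 (@renyi R) (cf2 l y) = y /\ digit_sum f (cf2 l y) l.1 = f (l.2.+2%:Z).
Proof.
case: l => [[|a] e] // f2 /andP[/= _ e0] y01; elim: a => [|a [IH1 IH2]].
  by have [D E] := digit_cf2_1 e0 y01; rewrite /= E /digit_sum big_ord1 /= D.
have [D E] := digit_cf2 a e0 y01.
rewrite iterSr E; split=> //.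
by rewrite -add1n digit_sumD /= E IH2 /digit_sum big_ord1 /= D f2 add0r.
Qed.

Lemma digit_sum_cf2w (R : realType) (f : int -> R) w (y : R) :
  f 2 = 0 -> all pos_letter w -> 0 <= y < 1 ->
  iter (word_length w) (@renyi R) (cf2w w y) = y /\
  digit_sum f (cf2w w y) (word_length w) = word_sum f w.
Proof.
move=> f2 + y01; elim: w => [|l w IH].
  by rewrite /word_length /word_sum /digit_sum !big_nil big_ord0.
rewrite /= => /andP[lp wp]; have [IH1 IH2] := IH wp.
have c01 : 0 <= cf2w w y < 1.
  have [-> //|wn] := eqVneq w [::]; have /andP[y0 y1] := y01.
  by have /andP[/ltW -> ->] := cf2w_in01 wp wn y0.
have [E S] := digit_sum_cf2 f2 lp c01.
rewrite /word_length /word_sum !big_cons -/(word_length w) -/(word_sum f w).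
by rewrite digit_sumD E S IH2 addnC iterD E.
Qed.

Lemma digit_sum_expansion (R : realType) (f : int -> R) (W : nat -> seq (nat * nat))
    (x : nat -> R) n :
  f 2 = 0 -> (forall n, all pos_letter (W n)) ->
  (forall n, 0 < x n < 1) -> (forall n, x n = cf2w (W n) (x n.+1)) ->
  let N := (\sum_(i < n) word_length (W i))%N in
  iter N (@renyi R) (x 0%N) = x n /\
  digit_sum f (x 0%N) N = \sum_(i < n) word_sum f (W i).
Proof.
move=> f2 Wp x01 xE; elim: n => [|n [IH1 IH2]].
  by rewrite /= /digit_sum !big_ord0.
have x01' : 0 <= x n.+1 < 1 by have /andP[/ltW -> ->] := x01 n.+1.
have [E S] := digit_sum_cf2w f2 (Wp n) x01'; rewrite -xE in E S.
by rewrite /= !big_ord_recr /= digit_sumD IH1 IH2 S addnC iterD IH1 E.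
Qed.

(** * Power means *)

Lemma exprS_le (R : realType) (x : R) a : 0 <= x ->
  (x + 1) ^+ a.+1 <= x ^+ a.+1 + a.+1%:R * (x + 1) ^+ a.
Proof.
move=> x0; elim: a => [|a IH]; first by rewrite !expr1 expr0 mulr1.
have xa : x ^+ a.+1 <= (x + 1) ^+ a.+1 by rewrite lerXn2r ?nnegrE ?addr_ge0 // lerDl.
rewrite exprS; apply: (@le_trans _ _ ((x + 1) * (x ^+ a.+1 + a.+1%:R * (x + 1) ^+ a))).
  by rewrite ler_wpM2l // addr_ge0.
rewrite -[a.+2%:R]natr1 -subr_ge0.
have -> : x ^+ a.+2 + (a.+1%:R + 1) * (x + 1) ^+ a.+1
  - (x + 1) * (x ^+ a.+1 + a.+1%:R * (x + 1) ^+ a) = (x + 1) ^+ a.+1 - x ^+ a.+1.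
  by rewrite ![_ ^+ _.+1]exprS; ring.
by rewrite subr_ge0.
Qed.

Lemma lower_power_eventually_le (R : realType) (C e : R) a : 0 <= C -> 0 < e ->
  exists k0, forall k, (k0 <= k)%N -> C * (k.+2%:R) ^+ a <= e * k%:R ^+ a.+1.
Proof.
(* The constant 3 comes from k + 2 <= 3 k for k >= 1. *)
move=> C0 e0; pose k0 := (Num.truncn (C * 3 ^+ a / e)).+1; exists k0 => k kk.
have k1 : 1 <= k%:R :> R by rewrite ler1n; apply: leq_trans kk.
have kC : C * 3 ^+ a / e <= k%:R.
  by apply: (le_trans (ltW (truncnS_gt _))); rewrite ler_nat.
rewrite ler_pdivrMr // in kC.
apply: (@le_trans _ _ (C * (3 * k%:R) ^+ a)).
  rewrite ler_wpM2l // lerXn2r ?nnegrE // -[k.+2]addn2 natrD; lra.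
rewrite exprMn mulrA exprS [e * _]mulrA ler_wpM2r ?exprn_ge0 //; lra.
Qed.

(** In the application, N n is the number of digits in the first n stages, kappa n the number of
    insertions among them, g m the total excess over 2^r of the first m digits, and z j the part of
    it due to the j-th insertion. The original letters enter only through errors of order kappa^a,
    against main terms of order kappa^(a + 1). *)
Section DigitMean.
Variables (R : realType) (g : nat -> R) (N kappa : nat -> nat) (z : nat -> R) (a : nat) (C : R).
Let Z k := \sum_(j < k) z j.
Hypothesis g_nd : {homo g : m n / (m <= n)%N >-> m <= n}.
Hypothesis N0 : N 0%N = 0%N.
Hypothesis N_nd : {homo N : m n / (m <= n)%N >-> (m <= n)%N}.
Hypothesis kappa_nd : {homo kappa : m n / (m <= n)%N >-> (m <= n)%N}.
Hypothesis kappaS : forall n, (kappa n.+1 <= (kappa n).+1)%N.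
Hypothesis kappa_unbounded : forall k, exists n, (k <= kappa n)%N.
Hypothesis C0 : 0 <= C.
Hypothesis N_ge : forall n, (kappa n)%:R ^+ a.+1 <= (N n)%:R :> R.
Hypothesis N_le : forall n, (N n)%:R <= (kappa n)%:R ^+ a.+1 + C * (kappa n).+1%:R ^+ a.
Hypothesis g_ge : forall n, Z (kappa n) <= g (N n).
Hypothesis g_le : forall n, g (N n) <= Z (kappa n) + C * (kappa n).+1%:R ^+ a.
Hypothesis z0 : forall j, 0 <= z j.
Let L (j : nat) : R := j.+1%:R ^+ a.+1 - j%:R ^+ a.+1.

Lemma stage_of (k0 : nat) : exists m0, forall m, (m0 <= m)%N ->
  exists n, [/\ (k0 <= kappa n)%N, (N n <= m)%N & (m < N n.+1)%N].
Proof.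
have [n0 kn0] := kappa_unbounded k0.
exists (N n0) => m mN.
have ex : exists n, (m < N n.+1)%N.
  have [n kn] := kappa_unbounded m.+1; exists n.
  have := N_ge n.+1; rewrite -natrX ler_nat; apply: leq_trans.
  apply: (leq_trans kn); apply: (leq_trans (kappa_nd (leqnSn n))).
  by case: (kappa n.+1) => // j; rewrite -{1}[j.+1]expn1 leq_pexp2l.
case: (ex_minnP ex) => n mn nmin; exists n; split=> //.
  apply: (leq_trans kn0); apply: kappa_nd.
  rewrite leqNgt; apply/negP => nn0.
  by have := leq_trans mn (N_nd nn0); rewrite ltnNge mN.
case: n {mn} nmin => [|n] nmin; first by rewrite N0.
by rewrite leqNgt; apply/negP => /nmin; rewrite ltnn.
Qed.

Lemma Z_nd k k' : (k <= k')%N -> Z k <= Z k'.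
Proof.
move=> kk; rewrite -(subnKC kk) /Z big_split_ord /= lerDl.
by apply: sumr_ge0 => i _; exact: z0.
Qed.

Lemma sum_L j0 k : (j0 <= k)%N -> \sum_(j0 <= j < k) L j = k%:R ^+ a.+1 - j0%:R ^+ a.+1.
Proof. by move=> jk; rewrite (telescope_sumr (fun j => j%:R ^+ a.+1) jk). Qed.

Lemma Z_split j0 k : (j0 <= k)%N -> Z k = Z j0 + \sum_(j0 <= j < k) z j.
Proof. by move=> jk; rewrite /Z -!(big_mkord xpredT z) (big_cat_nat (leq0n j0) jk). Qed.

Lemma powS_le k : k.+1%:R ^+ a.+1 <= k%:R ^+ a.+1 + a.+1%:R * k.+2%:R ^+ a :> R.
Proof.
rewrite -[k.+1%:R]natr1; apply: (le_trans (exprS_le a (ler0n R k))).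
rewrite lerD2l ler_wpM2l // lerXn2r ?nnegrE // natr1 //.
by rewrite ler_nat.
Qed.

(** Inside a stage with k = kappa n, monotonicity of g suffices: m exceeds k^(a + 1) by at most a
    multiple of (k + 2)^a, and the slack c1 - c' absorbs such terms once k is large. *)
Lemma digit_mean_ge c1 c' : 0 <= c' -> c' < c1 ->
  (exists j0, forall j, (j0 <= j)%N -> c1 * L j <= z j) ->
  exists m0, forall m, (m0 <= m)%N -> c' * m%:R <= g m.
Proof.
move=> c'0 c'1 [j0 zL].
pose D := c1 * j0%:R ^+ a.+1 + c' * (a.+1%:R + C).
have D0 : 0 <= D by rewrite addr_ge0 ?mulr_ge0 ?exprn_ge0 ?addr_ge0 //; lra.
have e0 : 0 < c1 - c' by rewrite subr_gt0.
have [k1 H1] := lower_power_eventually_le a D0 e0.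
have [m0 Hm] := stage_of (maxn j0 k1).
exists m0 => m mm; have [n [kn Nm mN]] := Hm _ mm.
move: kn; rewrite geq_max => /andP[jk kk].
set k := kappa n in jk kk.
have H := H1 _ kk.
have P1 : 1 <= k.+2%:R ^+ a :> R by rewrite exprn_ege1 // ler1n.
have gm : c1 * (k%:R ^+ a.+1 - j0%:R ^+ a.+1) <= g m.
  apply: le_trans (g_nd Nm); apply: le_trans (g_ge n); rewrite -/k (Z_split jk).
  apply: (@le_trans _ _ (\sum_(j0 <= j < k) z j)); last by rewrite lerDr sumr_ge0.
  by rewrite -sum_L // mulr_sumr; apply: ler_sum_nat => j /andP[jj _]; exact: zL.
apply: le_trans gm.
have kS : (kappa n.+1 <= k.+1)%N by exact: kappaS.
have mU : m%:R <= k%:R ^+ a.+1 + (a.+1%:R + C) * k.+2%:R ^+ a.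
  apply: (@le_trans _ _ (N n.+1)%:R); first by rewrite ler_nat ltnW.
  apply: (le_trans (N_le _)); rewrite mulrDl addrA; apply: lerD.
    apply: le_trans (powS_le k).
    by rewrite lerXn2r ?nnegrE // ler_nat.
  by rewrite ler_wpM2l // lerXn2r ?nnegrE // ler_nat.
have {}mU := ler_wpM2l c'0 mU; apply: (le_trans mU).
have : c1 * j0%:R ^+ a.+1 <= c1 * j0%:R ^+ a.+1 * k.+2%:R ^+ a.
  by rewrite ler_peMr // mulr_ge0 ?exprn_ge0 //; lra.
rewrite /D in H; lra.
Qed.

Lemma digit_mean_le c1 c' : 0 <= c1 -> c1 < c' ->
  (exists j0, forall j, (j0 <= j)%N -> z j <= c1 * L j) ->
  exists m0, forall m, (m0 <= m)%N -> g m <= c' * m%:R.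
Proof.
move=> c10 c'1 [j0 zL].
have Z0 : 0 <= Z j0 by rewrite sumr_ge0.
pose D := Z j0 + c1 * a.+1%:R + C.
have D0 : 0 <= D by rewrite !addr_ge0 ?mulr_ge0 //.
have e0 : 0 < c' - c1 by rewrite subr_gt0.
have [k1 H1] := lower_power_eventually_le a D0 e0.
have [m0 Hm] := stage_of (maxn j0 k1).
exists m0 => m mm; have [n [kn Nm mN]] := Hm _ mm.
move: kn; rewrite geq_max => /andP[jk kk].
set k := kappa n in jk kk.
have H := H1 _ kk.
have P1 : 1 <= k.+2%:R ^+ a :> R by rewrite exprn_ege1 // ler1n.
have mL : c' * k%:R ^+ a.+1 <= c' * m%:R.
  rewrite ler_wpM2l //; first by lra.
  by apply: (le_trans (N_ge n)); rewrite ler_nat.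
apply: le_trans mL.
have kS : (kappa n.+1 <= k.+1)%N by exact: kappaS.
have gU : g m <= Z k.+1 + C * k.+2%:R ^+ a.
  apply: (le_trans (g_nd (ltnW mN))); apply: (le_trans (g_le _)); apply: lerD.
    exact: Z_nd.
  by rewrite ler_wpM2l // lerXn2r ?nnegrE // ler_nat.
apply: (le_trans gU).
have ZU : Z k.+1 <= Z j0 + c1 * k.+1%:R ^+ a.+1.
  rewrite (Z_split (leqW jk)) lerD2l.
  apply: (@le_trans _ _ (c1 * (k.+1%:R ^+ a.+1 - j0%:R ^+ a.+1))); last first.
    by rewrite ler_wpM2l // gerBl exprn_ge0.
  by rewrite -sum_L ?(leqW jk) // mulr_sumr; apply: ler_sum_nat => j /andP[jj _]; exact: zL.
have kU := ler_wpM2l c10 (powS_le k).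
have : Z j0 <= Z j0 * k.+2%:R ^+ a by rewrite ler_peMr.
rewrite /D in H; lra.
Qed.

End DigitMean.

(** * Subexponential growth *)

Definition subexp (R : realType) (u : nat -> nat) : Prop :=
  forall lam : R, 1 < lam -> exists2 K : R, 0 <= K & forall n, (u n)%:R <= K * lam ^+ n.

Lemma subexp_le (R : realType) (u v : nat -> nat) :
  (forall n, (u n <= v n)%N) -> subexp R v -> subexp R u.
Proof.
move=> uv sv lam l1; have [K K0 H] := sv lam l1; exists K => // n.
by apply: le_trans (H n); rewrite ler_nat.
Qed.

Lemma subexp_cst (R : realType) c : subexp R (fun=> c).
Proof.
move=> lam l1; exists c%:R => // n; rewrite ler_peMr // exprn_ege1 //; exact: ltW.
Qed.

Lemma subexpD (R : realType) u v : subexp R u -> subexp R v ->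
  subexp R (fun n => u n + v n)%N.
Proof.
move=> su sv lam l1; have [K K0 H] := su lam l1; have [K' K0' H'] := sv lam l1.
exists (K + K'); first by rewrite addr_ge0.
by move=> n; rewrite natrD mulrDl lerD.
Qed.

Lemma subexpM (R : realType) u v : subexp R u -> subexp R v ->
  subexp R (fun n => u n * v n)%N.
Proof.
move=> su sv lam l1.
have l0 : 0 <= lam by lra.
(* The rate is shared equally between the two factors. *)
have s1 : 1 < Num.sqrt lam by rewrite -[ltLHS]sqrtr1 ltr_sqrt //; lra.
have [K K0 H] := su _ s1; have [K' K0' H'] := sv _ s1.
exists (K * K'); first by rewrite mulr_ge0.
move=> n; rewrite natrM -{1}(sqr_sqrtr l0) -exprM mul2n -addnn exprD mulrACA.
by apply: ler_pM.
Qed.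

Lemma subexpX (R : realType) u m : subexp R u -> subexp R (fun n => u n ^ m)%N.
Proof.
move=> su; elim: m => [|m IH]; first exact: subexp_cst.
by apply: (subexp_le _ (subexpM su IH)) => n; rewrite expnS.
Qed.

Lemma subexpS (R : realType) : subexp R S.
Proof.
move=> lam l1; exists ((lam - 1)^-1 + 1) => [|n].
  by rewrite addr_ge0 // invr_ge0; lra.
have h0 : 0 < lam - 1 by lra.
(* Bernoulli's inequality. *)
have B : 1 + n%:R * (lam - 1) <= lam ^+ n.
  elim: n => [|n IH]; first by rewrite mul0r addr0.
  rewrite exprS; apply: (@le_trans _ _ (lam * (1 + n%:R * (lam - 1)))).
    have : 0 <= n%:R * (lam - 1) ^+ 2 by rewrite mulr_ge0 // sqr_ge0.
    by rewrite -natr1 expr2; lra.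
  by rewrite ler_wpM2l //; lra.
have i0 : 0 < (lam - 1)^-1 by rewrite invr_gt0.
apply: (@le_trans _ _ (((lam - 1)^-1 + 1) * (1 + n%:R * (lam - 1)))).
  rewrite mulrDr mulr1 mulrDl mulrCA mulVf ?gt_eqF // mulr1 -natr1.
  have : 0 <= 1 * (n%:R * (lam - 1)) by rewrite mul1r mulr_ge0 // ltW.
  lra.
by rewrite ler_wpM2l // addr_ge0 // ltW.
Qed.

Lemma subexp_powR (R : realType) u (r : R) : 0 < r -> subexp R u ->
  subexp R (fun n => (Num.truncn (((u n)%:R : R) `^ r^-1)).+1).
Proof.
move=> r0 su; suff H : subexp R (fun n => (Num.truncn (((u n)%:R : R) `^ r^-1))).
  apply: (@subexp_le _ _ (fun n => Num.truncn (((u n)%:R : R) `^ r^-1) + 1)%N).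
    by move=> n; rewrite addn1.
  by apply: subexpD => //; exact: subexp_cst.
move=> lam l1.
have lr : 1 < lam `^ r.
  have := gt0_ltr_powR r0 (_ : 1 \is Num.nneg) (_ : lam \is Num.nneg) l1.
  by rewrite powR1 => -> //; rewrite nnegrE; lra.
have [K K0 H] := su _ lr; exists (K `^ r^-1); first exact: powR_ge0.
move=> n; apply: (@le_trans _ _ (((u n)%:R : R) `^ r^-1)); first by rewrite truncn_le powR_ge0.
apply: (@le_trans _ _ ((K * (lam `^ r) ^+ n) `^ r^-1)).
  by rewrite ge0_ler_powR ?nnegrE ?invr_ge0 ?mulr_ge0 ?exprn_ge0 ?powR_ge0 // ltW.
rewrite powRM ?exprn_ge0 ?powR_ge0 // ler_wpM2l ?powR_ge0 //.
rewrite -powR_mulrn ?powR_ge0 // -!powRrM.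
rewrite [X in lam `^ X](_ : _ = n%:R) ?powR_mulrn //; first by lra.
by field; rewrite gt_eqF.
Qed.

(** With mu the square root of lam and K <= mu^p, the product is at most mu^(p k + k^2), and p k +
    k^2 <= p^2 + 2 k^2. For k the integer square root of n the bound is of order lam^n, so
    insertions at the squares are affordable. *)
Lemma subexp_prod (R : realType) u (lam : R) : (forall j, 0 < u j)%N -> subexp R u -> 1 < lam ->
  exists2 K : R, 0 <= K & forall k, (\prod_(j < k) u j)%:R <= K * lam ^+ (k ^ 2).
Proof.
move=> u0 su l1.
have l0 : 0 <= lam by lra.
have m1 : 1 < Num.sqrt lam by rewrite -[ltLHS]sqrtr1 ltr_sqrt //; lra.
have [K K0 H] := su _ m1; set mu := Num.sqrt lam in m1 H.
have m1' : 1 <= mu by exact: ltW.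
have [p Kp] : exists p, K <= mu ^+ p.
  (* From K K2 < p + 1 <= K2 mu^p one gets K <= mu^p. *)
  have [K2 K20 H2] := subexpS m1; pose p := Num.truncn (K * K2).
  have : K * K2 < p.+1%:R by exact: truncnS_gt.
  have K2p : 0 < K2.
    by rewrite lt_def K20 andbT; apply/eqP => K2E; have := H2 0%N; rewrite K2E mul0r ler10.
  move=> /ltW /le_trans /(_ (H2 p)); rewrite [K * K2]mulrC ler_pM2l // => ?.
  by exists p.
exists (mu ^+ (p ^ 2)); first by rewrite exprn_ge0 //; lra.
move=> k; apply: (@le_trans _ _ (mu ^+ (p * k + k ^ 2))).
  elim: k => [|k IH]; first by rewrite big_ord0 muln0 expr0.
  rewrite big_ord_recr /= natrM; apply: (le_trans (ler_pM _ _ IH (H k))) => //.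
  apply: (@le_trans _ _ (mu ^+ (p * k + k ^ 2) * (mu ^+ p * mu ^+ k))).
    by rewrite ler_wpM2l ?exprn_ge0 ?ler_wpM2r ?exprn_ge0 //; lra.
  rewrite -!exprD ler_eXn2l //; nia.
rewrite -(sqr_sqrtr l0) -/mu -exprM -exprD ler_eXn2l //; nia.
Qed.

Lemma sqrtn_spec n : (Nat.sqrt n ^ 2 <= n < (Nat.sqrt n).+1 ^ 2)%N.
Proof. by have := PeanoNat.Nat.sqrt_spec n (PeanoNat.Nat.le_0_l n); lia. Qed.

Lemma sqrtn_nd : {homo Nat.sqrt : m n / (m <= n)%N}.
Proof. by move=> m n mn; have := sqrtn_spec m; have := sqrtn_spec n; nia. Qed.

Lemma sqrtnS n : (Nat.sqrt n.+1 <= (Nat.sqrt n).+1)%N.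
Proof. by have := sqrtn_spec n; have := sqrtn_spec n.+1; nia. Qed.

Lemma sqrtnS_eq n : Nat.sqrt n.+1 != Nat.sqrt n -> Nat.sqrt n.+1 = (Nat.sqrt n).+1.
Proof. by have := sqrtnS n; have := sqrtn_nd (leqnSn n); lia. Qed.

Lemma subexp_sqrtn (R : realType) u : subexp R u -> subexp R (fun n => u (Nat.sqrt n)).
Proof.
move=> su lam l1; have [K K0 H] := su lam l1; exists K => // n.
apply: (le_trans (H _)); rewrite ler_wpM2l // ler_eXn2l //.
by have := sqrtn_spec n; nia.
Qed.

Definition gap_power (a k : nat) : nat := (k.+1 ^ a.+1 - k ^ a.+1)%N.

(* One letter is inserted right before each position k.+1 ^ 2, which is sparse enough to
   leave the dimension unchanged.  The first k insertions contribute k ^ a.+1 digits up to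
   their last one, which dominates the contribution of the other letters. *)
Definition insertion (a : nat) (B : nat -> nat) (n : nat) : option (nat * nat) :=
  let k := Nat.sqrt n in
  if Nat.sqrt n.+1 == k then None else Some (gap_power a k, B k).

Lemma gap_power_gt a k : (k < gap_power a.+1 k)%N.
Proof.
rewrite /gap_power !(expnS _ a.+1).
have H1 : (k < k.+1 ^ a.+1)%N by rewrite -{1}[k.+1]expn1 leq_pexp2l.
have H2 : (k ^ a.+1 <= k.+1 ^ a.+1)%N by rewrite leq_exp2r.
have := leq_mul (leqnn k) H2; rewrite [(k.+1 * _)%N]mulSn; lia.
Qed.

Lemma gap_power_le a k : (gap_power a k <= k.+1 ^ a.+1)%N.
Proof. exact: leq_subr. Qed.

(** Only the positions n at which the integer square root jumps contribute, so the product is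
    reindexed by that root k. There n < (k + 1)^2, which bounds [letter_bound n]. *)
Lemma insertion_cost_le a B n :
  (\prod_(i < n) ins_cost (insertion a B) i <=
   \prod_(j < Nat.sqrt n) ((gap_power a j).+1 * (B j).+1 * (letter_bound (j.+1 ^ 2)).+1))%N.
Proof.
elim: n => [|n IH]; first by rewrite !big_ord0.
rewrite big_ord_recr /= {2}/ins_cost /insertion.
case: eqVneq => [->|/sqrtnS_eq ->]; first by rewrite muln1.
rewrite big_ord_recr /=; apply: leq_mul => //; rewrite leq_mul2l ltnS /letter_bound leq_mul2l /=.
have /andP[_ H] := sqrtn_spec n.
by apply: leq_mul; rewrite !ltnS ltnW.
Qed.

Lemma subexp_letter_bound (R : realType) u : subexp R u ->
  subexp R (fun n => letter_bound (u n)).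
Proof.
move=> su; have su1 m : subexp R (fun n => u n + m)%N by apply: subexpD => //; exact: subexp_cst.
apply: (@subexp_le _ _ (fun n => 12 * ((u n + 1) * (u n + 2)))%N).
  by move=> n; rewrite /letter_bound addn1 addn2.
by apply: subexpM; [exact: subexp_cst|exact: subexpM].
Qed.

(** The index [n.+1] accounts for the look-ahead to the next original letter in
    [insertion_separation]. *)
Definition insertion_bound (a : nat) (B : nat -> nat) (n : nat) : nat :=
  (letter_bound n.+1 + gap_power a (Nat.sqrt n) + B (Nat.sqrt n))%N.

Lemma subexp_separation (R : realType) a B : subexp R B ->
  subexp R (separation (insertion a B) (insertion_bound a B)).
Proof.
move=> sB.
have sS u : subexp R u -> subexp R (fun n => (u n).+1).
  move=> su; apply: (@subexp_le _ _ (fun n => u n + 1)%N); first by move=> n; rewrite addn1.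
  by apply: subexpD => //; exact: subexp_cst.
have sG : subexp R (gap_power a).
  by apply: (subexp_le (gap_power_le a)); apply: subexpX; exact: subexpS.
have sM : subexp R (insertion_bound a B).
  apply: subexpD; last exact: subexp_sqrtn sB.
  apply: subexpD; last exact: subexp_sqrtn sG.
  by apply: subexp_letter_bound; exact: subexpS.
have sP : subexp R (fun n => \prod_(i < n) ins_cost (insertion a B) i)%N.
  move=> lam l1.
  have sC : subexp R (fun j => (gap_power a j).+1 * (B j).+1 * (letter_bound (j.+1 ^ 2)).+1)%N.
    apply: subexpM; first by apply: subexpM; apply: sS.
    by apply: sS; apply: subexp_letter_bound; apply: subexpX; exact: subexpS.
  have [|K K0 H] := subexp_prod _ sC l1; first by move=> j; rewrite !muln_gt0.
  exists K => // n.
  apply: (@le_trans _ _ (\prod_(j < Nat.sqrt n)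
    ((gap_power a j).+1 * (B j).+1 * (letter_bound (j.+1 ^ 2)).+1))%N%:R).
    by rewrite ler_nat insertion_cost_le.
  apply: (le_trans (H _)); rewrite ler_wpM2l // ler_eXn2l //.
  by have /andP[] := sqrtn_spec n.
apply: subexpM; last by apply: subexpX; exact: (sS _ (sS _ sM)).
by apply: subexpM; [exact: subexp_cst|exact: subexpX].
Qed.

(** * The inserted letters *)

Lemma digit_ge2 (R : realType) (x : R) : 0 <= x < 1 -> (2 <= (digit x)%:~R :> R).
Proof.
move=> /andP[x0 x1]; rewrite /digit intrD -lerBlDr (_ : 2 - 1%:~R = 1%:~R :> R); last by ring.
rewrite ler_int floor_ge_int /= -[1%:~R]invr1 lef_pV2 ?posrE; lra.
Qed.

(** Subtracting 2^r makes the function vanish at the digit 2 and shifts the power mean by the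
    constant 2^r. *)
Definition excess (R : realType) (r : R) (b : int) : R := b%:~R `^ r - 2 `^ r.

Lemma excess_ge0 (R : realType) (r : R) b : 0 < r -> (2 <= b%:~R :> R) -> 0 <= excess r b.
Proof. by move=> r0 b2; rewrite subr_ge0 ge0_ler_powR ?nnegrE // ?ltW //; lra. Qed.

Lemma digit_mean_excess (R : realType) (r : R) x n : (0 < n)%N ->
  digit_mean r x n = 2 `^ r + digit_sum (excess r) x n / n%:R.
Proof.
move=> n0; have nn : n%:R != 0 :> R by rewrite pnatr_eq0 -lt0n.
rewrite /digit_sum /excess sumrB sumr_const card_ord -[X in _ - X]mulr_natr mulrBl mulfK //.
by rewrite subrKC mulrC /digit_mean big_add1 /= big_mkord.
Qed.

Lemma digit_sum_nd (R : realType) (r : R) x : 0 < r -> 0 <= x < 1 ->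
  {homo digit_sum (excess r) x : m n / (m <= n)%N >-> m <= n}.
Proof.
move=> r0 x01 m n mn; rewrite -(subnKC mn) digit_sumD lerDl sumr_ge0 // => k _.
apply/excess_ge0/digit_ge2 => //; rewrite -iterD; case: (_ + _)%N => [|j] //=.
exact: renyi_in01.
Qed.

Section InsertedExpansion.
Variables (R : realType) (r : R) (a : nat) (B : nat -> nat) (l : nat -> nat * nat).
Hypothesis lb : forall k, letter_le (letter_bound k) (l k).
Let W := stage (insertion a B) l.

Lemma sum_stage_length n : (\sum_(i < n) word_length (W i) =
  \sum_(i < n) (l i).1 + Nat.sqrt n ^ a.+1)%N.
Proof.
elim: n => [|n IH]; first by rewrite !big_ord0 exp0n.
rewrite !big_ord_recr /= IH /W /stage /insertion /word_length big_cons.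
case: eqVneq => [->|/sqrtnS_eq ->] /=; first by rewrite big_nil; lia.
have H : (Nat.sqrt n ^ a.+1 <= (Nat.sqrt n).+1 ^ a.+1)%N by rewrite leq_exp2r.
by rewrite big_seq1 /= /gap_power addnACA subnKC.
Qed.

Lemma sum_stage_digits (f : int -> R) n : \sum_(i < n) word_sum f (W i) =
  \sum_(i < n) f ((l i).2.+2%:Z) + \sum_(j < Nat.sqrt n) f ((B j).+2%:Z).
Proof.
elim: n => [|n IH]; first by rewrite !big_ord0 addr0.
rewrite !big_ord_recr /= IH /W /stage /insertion /word_sum big_cons.
case: eqVneq => [->|/sqrtnS_eq ->] /=; first by rewrite big_nil; ring.
by rewrite big_seq1 big_ord_recr /=; ring.
Qed.

Lemma letter_bound_sqrtn i n : (i < n)%N ->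
  (letter_bound i <= 12 * (Nat.sqrt n).+1 ^ 4)%N.
Proof.
move=> ilt; have /andP[_ H] := sqrtn_spec n.
rewrite /letter_bound leq_mul2l /= (expnM _ 2 2); set s := (_ ^ 2)%N in H *.
by rewrite -[(s ^ 2)%N]mulnn leq_mul //; lia.
Qed.

Lemma sum_letters_le n : (\sum_(i < n) (l i).1 <= 12 * (Nat.sqrt n).+1 ^ 6)%N.
Proof.
apply: (@leq_trans (\sum_(i < n) 12 * (Nat.sqrt n).+1 ^ 4)).
  apply: leq_sum => i _; have /and4P[_ H _ _] := lb i.
  exact: leq_trans H (letter_bound_sqrtn _).
rewrite sum_nat_const card_ord mulnCA leq_mul2l /=.
rewrite (expnD _ 2 4) leq_mul2r; apply/orP; right.
by have /andP[_ /ltnW] := sqrtn_spec n.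
Qed.

(** With s = [sqrt n] + 1 there are at most s^2 terms, and each digit is at most 12 s^4 + 2 <= 14
    s^4. *)
Lemma sum_excess_le rho n : 0 < r -> r <= rho%:R ->
  \sum_(i < n) excess r ((l i).2.+2%:Z) <= 14 ^+ rho * (Nat.sqrt n).+1%:R ^+ (4 * rho + 2).
Proof.
move=> r0 rrho; set s : R := (Nat.sqrt n).+1%:R.
have s1 : 1 <= s by rewrite ler1n.
apply: (@le_trans _ _ (\sum_(i < n) 14 ^+ rho * s ^+ (4 * rho))).
  apply: ler_sum => i _; rewrite /excess.
  apply: (@le_trans _ _ (((l i).2.+2%:~R : R) `^ r)); first by rewrite gerBl powR_ge0.
  have H1 : ((l i).2.+2%:~R : R) <= 14 * s ^+ 4.
    have /and4P[_ _ _ H] := lb i; have {}H := leq_trans H (letter_bound_sqrtn (ltn_ord i)).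
    have s4 : 1 <= s ^+ 4 by rewrite exprn_ege1.
    rewrite -(ler_nat R) natrM natrX -/s in H.
    by rewrite -pmulrn -addn2 natrD; lra.
  apply: (@le_trans _ _ ((14 * s ^+ 4) `^ r)).
    by rewrite ge0_ler_powR ?nnegrE ?mulr_ge0 ?exprn_ge0 // ltW.
  apply: (@le_trans _ _ ((14 * s ^+ 4) `^ rho%:R)).
    rewrite ler_powR // -[leLHS]mulr1 ler_pM ?exprn_ege1 //.
    by rewrite (ler_nat _ 1 14).
  by rewrite powR_mulrn ?mulr_ge0 ?exprn_ge0 // exprMn exprM.
rewrite sumr_const card_ord -[leLHS]mulr_natl mulrCA ler_wpM2l ?exprn_ge0 //.
rewrite addnC exprD ler_wpM2r ?exprn_ge0 // -natrX ler_nat.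
by have /andP[_ /ltnW] := sqrtn_spec n.
Qed.

End InsertedExpansion.

Lemma powR_rootK (R : realType) (x r : R) : 0 < r -> 0 <= x -> (x `^ r^-1) `^ r = x.
Proof. by move=> r0 x0; rewrite -powRrM mulVf ?powRr1 // gt_eqF. Qed.

Lemma root_powRK (R : realType) (x r : R) : 0 < r -> 0 <= x -> (x `^ r) `^ r^-1 = x.
Proof. by move=> r0 x0; rewrite -powRrM mulfV ?powRr1 // gt_eqF. Qed.

Section TargetMean.
Variables (R : realType) (r : R) (alpha : \bar R).
Hypothesis r0 : 0 < r.
Hypothesis alpha_ge : ((2 `^ r)%:E <= alpha)%E.

Definition rate (j : nat) : R := if alpha is c%:E then c - 2 `^ r else j%:R.

(** Large enough to dominate the exponent 6 of [sum_letters_le] and the exponent 4 rho + 2 of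
    [sum_excess_le], where rho = [r] + 1. *)
Definition mean_exponent : nat := 4 * (Num.truncn r).+1 + 6.

(* Chosen so that the excess of the inserted digit B + 2 is about [rate j] times the
   length of the inserted run of digits 2. *)
Definition big_digit (j : nat) : nat :=
  (Num.truncn ((rate j * (gap_power mean_exponent j)%:R) `^ r^-1)).+1.

Lemma rate_ge0 j : 0 <= rate j.
Proof. by rewrite /rate; case: alpha alpha_ge => [c| |] //; rewrite lee_fin subr_ge0. Qed.

Lemma subexp_big_digit : subexp R big_digit.
Proof.
pose u j := ((Num.truncn (rate 0)).+1 + j)%N.
have ru j : rate j <= (u j)%:R.
  rewrite /u /rate natrD; case: alpha alpha_ge => [c| |] // _.
    by apply: (le_trans (ltW (truncnS_gt _))); rewrite lerDl.
  by rewrite lerDr.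
have su : subexp R (fun j => u j * gap_power mean_exponent j)%N.
  apply: subexpM; first apply: subexpD; first exact: subexp_cst.
    by apply: (subexp_le _ (@subexpS R)).
  apply: (subexp_le (gap_power_le mean_exponent)); apply: subexpX; exact: subexpS.
apply: subexp_le _ (subexp_powR r0 su) => j; rewrite ltnS; apply: le_truncn.
rewrite ge0_ler_powR ?nnegrE ?invr_ge0 ?mulr_ge0 ?rate_ge0 ?(ltW r0) //.
by rewrite natrM ler_wpM2r.
Qed.

Lemma gap_ge j : j%:R <= (gap_power mean_exponent j)%:R :> R.
Proof. by rewrite ler_nat ltnW // /mean_exponent addnS gap_power_gt. Qed.

(** The r-th power of the inserted digit is at least [rate j] times the gap, and the subtracted 2^r
    is at most d times the gap once j >= 2^r / d. *)
Lemma excess_big_digit_ge c1 d : 0 < d -> (exists j0, forall j, (j0 <= j)%N -> c1 + d <= rate j) ->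
  exists j0, forall j, (j0 <= j)%N ->
    c1 * (gap_power mean_exponent j)%:R <= excess r ((big_digit j).+2%:Z).
Proof.
move=> d0 [j0 H]; pose j1 := (Num.truncn (2 `^ r / d)).+1; exists (maxn j0 j1) => j.
rewrite geq_max => /andP[jj0 jj1]; have cd := H _ jj0.
have jd : 2 `^ r / d <= j%:R.
  by apply: (le_trans (ltW (truncnS_gt _))); rewrite ler_nat.
rewrite ler_pdivrMr // in jd.
have G := gap_ge j; set L := (gap_power _ _)%:R in G *.
have L0 : 0 <= L by rewrite (le_trans _ G).
have X0 : 0 <= rate j * L by rewrite mulr_ge0 ?rate_ge0.
have A : rate j * L <= ((big_digit j).+2%:~R : R) `^ r.
  rewrite -[leLHS](powR_rootK r0) // ge0_ler_powR ?nnegrE ?powR_ge0 ?(ltW r0) //.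
  apply: (le_trans (ltW (truncnS_gt _))); rewrite -pmulrn ler_nat /big_digit -/L.
  by rewrite ltnW // ltnW.
rewrite /excess; have P1 := ler_wpM2r L0 cd; have P2 := ler_wpM2l (ltW d0) G.
by rewrite mulrDl in P1; lra.
Qed.

(** Rounding and the shift by 2 add at most 3 to (c L)^(1/r), L being the gap, while (c1 L)^(1/r)
    exceeds it by a positive multiple of L^(1/r), which is unbounded. *)
Lemma excess_big_digit_le c c1 : (forall j, rate j = c) -> c < c1 ->
  exists j0, forall j, (j0 <= j)%N ->
    excess r ((big_digit j).+2%:Z) <= c1 * (gap_power mean_exponent j)%:R.
Proof.
move=> rc cc1; have c0 : 0 <= c by rewrite -(rc 0%N) rate_ge0.
have c10 : 0 <= c1 by lra.
have ri0 : 0 < r^-1 by rewrite invr_gt0.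
pose D := c1 `^ r^-1 - c `^ r^-1.
have D0 : 0 < D by rewrite subr_gt0 gt0_ltr_powR ?nnegrE.
exists (Num.truncn ((3 / D) `^ r)).+1 => j jj.
have jd : (3 / D) `^ r <= j%:R.
  by apply: (le_trans (ltW (truncnS_gt _))); rewrite ler_nat.
have G := gap_ge j; have {jd} := le_trans jd G.
rewrite /big_digit rc; set L := (gap_power _ _)%:R in G * => jd.
have L0 : 0 <= L by rewrite (le_trans _ G).
have T0 : 0 <= 3 / D by rewrite divr_ge0 // ltW.
have LD : 3 / D <= L `^ r^-1.
  by rewrite -[leLHS](root_powRK r0) // ge0_ler_powR ?nnegrE ?powR_ge0 ?(ltW ri0).
rewrite ler_pdivrMr // in LD.
rewrite /excess; apply: (@le_trans _ _ (((Num.truncn ((c * L) `^ r^-1)).+3%:~R : R) `^ r)).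
  by rewrite gerBl powR_ge0.
rewrite -[leRHS](powR_rootK r0) ?mulr_ge0 // ge0_ler_powR ?nnegrE ?powR_ge0 ?(ltW r0) //.
have : (Num.truncn ((c * L) `^ r^-1))%:R <= (c * L) `^ r^-1 by rewrite truncn_le powR_ge0.
rewrite -pmulrn -addn3 natrD !powRM // => ?; rewrite /D in LD; lra.
Qed.

End TargetMean.

Lemma pos_insertion a B k i : (forall j, 0 < B j)%N -> insertion a.+1 B k = Some i -> pos_letter i.
Proof.
move=> B0; rewrite /insertion; case: eqP => // _ [<-]; rewrite /pos_letter /= B0 andbT.
exact: leq_ltn_trans (gap_power_gt a _).
Qed.

Lemma pos_stage a B l n : (forall j, 0 < B j)%N -> (forall k, letter_le (letter_bound k) (l k)) ->
  all pos_letter (stage (insertion a.+1 B) l n).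
Proof.
move=> B0 lb; rewrite /stage /= (letter_le_pos (lb n)) /=.
by case insn : (insertion _ _ _) => [i|] //=; rewrite (pos_insertion B0 insn).
Qed.

Lemma insertion_le_bound a B k i : (forall j, 0 < B j)%N ->
  insertion a.+1 B k = Some i -> letter_le (insertion_bound a.+1 B k) i.
Proof.
move=> B0 ik; have /andP[i1 i2] := pos_insertion B0 ik.
apply/and4P; split=> //; move: ik; rewrite /insertion /insertion_bound; case: eqP => // _ [<-] /=.
  by rewrite -addnA addnCA leq_addr.
exact: leq_addl.
Qed.

(** * Membership of the inserted points in the level set *)

Section Membership.
Variables (R : realType) (r : R) (alpha : \bar R) (l : nat -> nat * nat).
Hypothesis r0 : 0 < r.
Hypothesis alpha_ge : ((2 `^ r)%:E <= alpha)%E.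
Hypothesis lb : forall k, letter_le (letter_bound k) (l k).
Let a := mean_exponent r.
Let W := stage (insertion a (big_digit r alpha)) l.
Let x n : R := cf_value R W n.

Let Wpos n : all pos_letter (W n).
Proof. by rewrite /W /a /mean_exponent addnS; exact: pos_stage. Qed.

Let x01 n : 0 < x n < 1.
Proof. exact: cf_value_in01. Qed.

Let xE n : x n = cf2w (W n) (x n.+1).
Proof. exact: cf_valueE. Qed.

Let rho := (Num.truncn r).+1.
Let N n := (\sum_(i < n) word_length (W i))%N.
Let g := digit_sum (excess r) (x 0%N).
Let z j := excess r ((big_digit r alpha j).+2%:Z).
(** A common bound for the constants 12 of [sum_letters_le] and 14^rho of [sum_excess_le]. *)
Let C : R := 12 * 14 ^+ rho.

Let f2 : excess r 2 = 0.
Proof. by rewrite /excess subrr. Qed.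

Let fpos (b : nat) : 0 <= excess r b.+2%:Z.
Proof. by apply: excess_ge0 => //; rewrite -pmulrn (ler_nat _ 2). Qed.

Let x0' : 0 <= x 0%N < 1.
Proof. by have /andP[/ltW -> ->] := x01 0%N. Qed.

Let C_ge0 : 0 <= C.
Proof. by rewrite mulr_ge0 ?exprn_ge0. Qed.

Let gN n : g (N n) = \sum_(i < n) excess r ((l i).2.+2%:Z) + \sum_(j < Nat.sqrt n) z j.
Proof.
have [_ E] := digit_sum_expansion n f2 Wpos x01 xE.
by rewrite /g /N E; exact: sum_stage_digits.
Qed.

Let N_nd : {homo N : m n / (m <= n)%N}.
Proof. by move=> m n mn; rewrite -(subnKC mn) /N big_split_ord /= leq_addr. Qed.

Let unbounded k : exists n, (k <= Nat.sqrt n)%N.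
Proof. by exists (k ^ 2)%N; have := sqrtn_spec (k ^ 2); nia. Qed.

Let N_ge n : (Nat.sqrt n)%:R ^+ a.+1 <= (N n)%:R :> R.
Proof. by rewrite -natrX ler_nat /N sum_stage_length // leq_addl. Qed.

Let pow_le p (k : nat) : (p <= a)%N -> k.+1%:R ^+ p <= k.+1%:R ^+ a :> R.
Proof. by move=> pa; rewrite ler_weXn2l // ler1n. Qed.

Let N_le n : (N n)%:R <= (Nat.sqrt n)%:R ^+ a.+1 + C * (Nat.sqrt n).+1%:R ^+ a.
Proof.
rewrite /N sum_stage_length // natrD natrX addrC lerD2l.
have := sum_letters_le lb n; rewrite -(ler_nat R) natrM natrX => H; apply: (le_trans H).
have P : (Nat.sqrt n).+1%:R ^+ 6 <= (Nat.sqrt n).+1%:R ^+ a :> R.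
  by apply: pow_le; rewrite leq_addl.
apply: (@le_trans _ _ (12 * (Nat.sqrt n).+1%:R ^+ a)); first by rewrite ler_wpM2l.
rewrite ler_wpM2r ?exprn_ge0 // /C ler_peMr // exprn_ege1 //.
by rewrite (ler_nat _ 1 14).
Qed.

Let g_ge n : \sum_(j < Nat.sqrt n) z j <= g (N n).
Proof. by rewrite gN lerDr sumr_ge0. Qed.

Let g_le n : g (N n) <= \sum_(j < Nat.sqrt n) z j + C * (Nat.sqrt n).+1%:R ^+ a.
Proof.
rewrite gN addrC lerD2l.
have rrho : r <= rho%:R by exact: ltW (truncnS_gt _).
apply: (le_trans (sum_excess_le lb n r0 rrho)).
have P : (Nat.sqrt n).+1%:R ^+ (4 * rho + 2) <= (Nat.sqrt n).+1%:R ^+ a :> R.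
  by apply: pow_le; rewrite leq_add2l.
apply: (@le_trans _ _ (14 ^+ rho * (Nat.sqrt n).+1%:R ^+ a)).
  by rewrite ler_wpM2l ?exprn_ge0.
rewrite ler_wpM2r ?exprn_ge0 // /C ler_peMl ?exprn_ge0 //.
by rewrite (ler_nat _ 1 12).
Qed.

Let gap_powerE j : (gap_power a j)%:R = j.+1%:R ^+ a.+1 - j%:R ^+ a.+1 :> R.
Proof. by rewrite /gap_power natrB ?natrX // leq_exp2r. Qed.

Let N0 : N 0%N = 0%N.
Proof. by rewrite /N big_ord0. Qed.

Let g_nd := digit_sum_nd r0 x0'.

Let excess_mean_ge c' c1 d : 0 <= c' -> c' < c1 -> 0 < d ->
  (exists j0, forall j, (j0 <= j)%N -> c1 + d <= rate r alpha j) ->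
  exists m0, forall m, (m0 <= m)%N -> c' * m%:R <= g m.
Proof.
move=> c'0 c'1 d0 /(excess_big_digit_ge r0 alpha_ge d0) [j0 H].
apply: (digit_mean_ge g_nd N0 N_nd sqrtn_nd sqrtnS unbounded C_ge0 N_ge N_le g_ge _ c'0 c'1).
  by move=> j; exact: fpos.
by exists j0 => j jj; rewrite -gap_powerE; exact: H.
Qed.

Let excess_mean_le c c' : (forall j, rate r alpha j = c) -> c < c' ->
  exists m0, forall m, (m0 <= m)%N -> g m <= c' * m%:R.
Proof.
move=> rc cc'; pose c1 := (c + c') / 2.
have c0 : 0 <= c by rewrite -(rc 0%N) rate_ge0.
have c1c : c < c1 by rewrite /c1; lra.
have [j0 H] := excess_big_digit_le r0 alpha_ge rc c1c.
have c10 : 0 <= c1 by lra.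
have c1c' : c1 < c' by rewrite /c1; lra.
apply: (digit_mean_le g_nd N0 N_nd sqrtn_nd sqrtnS unbounded C_ge0 N_ge g_le _ c10 c1c').
  by move=> j; exact: fpos.
by exists j0 => j jj; rewrite -gap_powerE; exact: H.
Qed.

Lemma inserted_in_digit_mean_set : digit_mean_set r alpha (x 0%N).
Proof.
split; first exact: x01.
  exact: cf_expansion_irrational Wpos _ x01 xE.
have g0 m : 0 <= g m by have := g_nd (leq0n m); rewrite /g /digit_sum big_ord0.
have meanE m : (0 < m)%N -> digit_mean r (x 0%N) m = 2 `^ r + g m / m%:R.
  exact: digit_mean_excess.
have m_gt0 (m : nat) : (0 < m)%N -> 0 < m%:R :> R by rewrite ltr0n.
have ge := excess_mean_ge; have le := excess_mean_le.
case: alpha alpha_ge ge le => [c| |] //=.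
- move=> c2 ge le; pose c0 := c - 2 `^ r.
  have c00 : 0 <= c0 by rewrite subr_ge0 -lee_fin.
  clear c2.
  apply/cvg_EFin; first exact: nearW.
  apply/cvgrPdist_le => e e0.
  have [m1 H1] : exists m0, forall m, (m0 <= m)%N -> (c0 - e) * m%:R <= g m.
    (* A negative lower rate is trivial because g is nonnegative. *)
    have [ce|ce] := ltP (c0 - e) 0.
      exists 0%N => m _; apply: le_trans (g0 m).
      by rewrite mulr_le0_ge0 // ltW.
    (* One half of e pays for the 2^r subtracted in [excess], the other for passing from stage ends
       to arbitrary m. *)
    apply: (ge _ (c0 - e / 2) (e / 2)) => //; try lra.
    by exists 0%N => j _; rewrite /rate /c0; lra.
  have [m2 H2] : exists m0, forall m, (m0 <= m)%N -> g m <= (c0 + e) * m%:R.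
    by apply: (le c0) => //; lra.
  near=> m.
  have m0 : (0 < m)%N by near: m; exact: nbhs_infty_gt.
  have m1m : (m1 <= m)%N by near: m; exact: nbhs_infty_ge.
  have m2m : (m2 <= m)%N by near: m; exact: nbhs_infty_ge.
  rewrite /= meanE //; have {}H1 := H1 _ m1m; have {}H2 := H2 _ m2m.
  rewrite -ler_pdivlMr ?m_gt0 // in H1; rewrite -ler_pdivrMr ?m_gt0 // in H2.
  by rewrite ler_norml; apply/andP; split; rewrite /c0 in H1 H2; lra.
- move=> _ ge _; apply/cvgeryP/cvgryPge => A.
  have [m1 H1] : exists m0, forall m, (m0 <= m)%N -> `|A| * m%:R <= g m.
    apply: (ge _ (`|A| + 1) 1) => //; first by lra.
    exists (Num.truncn (`|A| + 2)).+1 => j jj.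
    by apply: (@le_trans _ _ (`|A| + 2)); [lra|apply: (le_trans (ltW (truncnS_gt _))); rewrite ler_nat].
  near=> m.
  have m0 : (0 < m)%N by near: m; exact: nbhs_infty_gt.
  have m1m : (m1 <= m)%N by near: m; exact: nbhs_infty_ge.
  rewrite meanE //; have {}H1 := H1 _ m1m.
  rewrite -ler_pdivlMr ?m_gt0 // in H1.
  by have := powR_ge0 2 r; have := ler_norm A; lra.
Unshelve. all: by end_near.
Qed.

End Membership.

(** * Dimension of the level sets *)

Theorem theorem1p6 (R : realType) (r : R) (alpha : \bar R) :
  0 < r -> ((2 `^ r)%:E <= alpha)%E ->
  hausdorff_dim (digit_mean_set r alpha) = 1%E.
Proof.
move=> r0 alpha_ge; apply: hausdorff_dim_eq1.
  by move=> x [/andP[x0 x1] _ _]; rewrite /= in_itv /= x1 ltW.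
move=> s s0 s1.
pose B := big_digit r alpha; pose a := (mean_exponent r).-1.
have aE : mean_exponent r = a.+1 by rewrite /a /mean_exponent addnS.
have B0 j : (0 < B j)%N by [].
(* Cylinders of n letters have length at most 4^(-n), so a loss of order 4^((1 - s) n) lowers the
   Hoelder exponent from 1 to s. *)
have lam1 : 1 < (4 : R) `^ (1 - s).
  have := gt0_ltr_powR (_ : 0 < 1 - s) (_ : 1 \is Num.nneg) (_ : (4 : R) \is Num.nneg) (_ : 1 < 4).
  by rewrite powR1; apply; rewrite ?nnegrE //; lra.
have [K K0 HK] := subexp_separation a.+1 (subexp_big_digit r0 alpha_ge) lam1.
pose letters (t : R) k := cf2_letter (iter k (@cf2_tail R) t).
pose W t := stage (insertion a.+1 B) (letters t).
have lb t : tame t -> forall k, letter_le (letter_bound k) (letters t k).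
  by move=> [_ _ H] k; have [] := H k.
have Wp t : tame t -> forall k, all pos_letter (W t k).
  by move=> Tt k; apply: pos_stage => //; exact: lb.
(* The constant must be positive, whereas K is only known to be nonnegative; hence K + 1. *)
apply: (@hausdorff_measure_gt0 _ s (K + 1) (2^-1) (@tame R) _ (fun t => cf_value R (W t) 0)) => //.
- by rewrite ltr_wpDl.
- by move=> c d d0 cov; exact: (tame_fat d0 cov).
- by move=> t Tt; rewrite /W -aE; apply: inserted_in_digit_mean_set => //; exact: lb.
move=> t t' Tt Tt'.
apply: (@le_trans _ _ (K * `|cf_value R (W t) 0 - cf_value R (W t') 0| `^ s)); last first.
  by rewrite ler_wpM2r ?powR_ge0 // lerDl.
have tail01 u : tame u -> forall k, 0 <= iter k (@cf2_tail R) u <= 1.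
  by move=> [_ _ H] k; have [_ -> /ltW -> _] := H k.
have tailE u : tame u -> forall k,
    iter k (@cf2_tail R) u = cf2 (letters u k) (iter k.+1 (@cf2_tail R) u).
  by move=> [_ _ H] k; have [_ _ _ E] := H k.
have val01 u : tame u -> forall k, 0 <= cf_value R (W u) k <= 1.
  by move=> Tu k; have /andP[/ltW -> /ltW ->] := cf_value_in01 R (Wp _ Tu) (fun=> isT) k.
apply: (@insertion_holder _ (insertion a.+1 B) (insertion_bound a.+1 B) (letters t) (letters t')
  (fun k => iter k (@cf2_tail R) t) (fun k => iter k (@cf2_tail R) t')
  (cf_value R (W t)) (cf_value R (W t'))) => //.
- move=> k; rewrite /insertion_bound -addnA; apply: leq_trans (leq_addr _ _).
  by rewrite /letter_bound leq_mul2l /= leq_mul.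
- by move=> k; rewrite /insertion_bound -addnA leq_addr.
- by move=> k i; exact: insertion_le_bound.
- exact: lb.
- exact: lb.
- exact: tail01.
- exact: tail01.
- exact: val01.
- exact: val01.
- exact: tailE.
- exact: tailE.
- by move=> k; apply: cf_valueE; exact: Wp.
- by move=> k; apply: cf_valueE; exact: Wp.
Qed.
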